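(* Let $X,U_1,U_2,Z$ be Hilbert spaces, let $A$ generate a contractive $C_0$-semigroup on $X$, let $B_1\in\mathcal L(Z,X)$ and $B_2\in\mathcal L(U_2,X)$, and let $F\colon U_1\times X\to Z$ be bilinear and bounded. Consider the system with co-located output \[ \left\{\begin{aligned} \dot x(t)&=Ax(t)+B_1F(u_1(t),x(t))+B_2u_2(t),\qquad t\in(0,\infty),\\ x(0)&=x_0,\\ y(t)&=\begin{bmatrix} F_{x(t)}^*B_1^*x(t) \\ B_2^*x(t) \end{bmatrix}\in U_1\times U_2 . \end{aligned}\right. \] Then the following assertions hold. (i) If $u_1\in W^{1,1}_{\mathrm{loc}}([0,\infty);U_1)$, $u_2\in W^{1,1}_{\mathrm{loc}}([0,\infty);U_2)$ and $x_0\in D(A)$, then the classical solution $x$ of the system satisfies \[ \frac12\frac{\mathrm d}{\mathrm dt}\|x(t)\|_X^2\le \operatorname{Re}\left\langle\begin{bmatrix} u_1(t) \\ u_2(t) \end{bmatrix},y(t)\right\rangle_{U_1\times U_2}\qquad\text{for } t\in[0,\infty). \] (ii) If $u_1\in L^1_{\mathrm{loc}}([0,\infty);U_1)$, $u_2\in L^1_{\mathrm{loc}}([0,\infty);U_2)$ and $x_0\in X$, then the mild solution $x$ of the system satisfies \[ \frac12\|x(t)\|_X^2-\frac12\|x_0\|_X^2\le \operatorname{Re}\int_0^t\left\langle\begin{bmatrix} u_1(s) \\ u_2(s) \end{bmatrix},y(s)\right\rangle_{U_1\times U_2}\mathrm ds\qquad\text{for } t\in[0,\infty). \]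
   Context: Boundedness of $F$: there is $C>0$ with $\|F(u,x)\|_Z\le C\|u\|_{U_1}\|x\|_X$ for all $u\in U_1$, $x\in X$. For fixed $x\in X$, $F_x\in\mathcal L(U_1,Z)$ is given by $F_xu=F(u,x)$, and $F_x^*$, $B_1^*$, $B_2^*$ are the Hilbert space adjoints. Inner products are linear in the first argument, and $\left\langle\begin{bmatrix} v_1 \\ v_2 \end{bmatrix},\begin{bmatrix} w_1 \\ w_2 \end{bmatrix}\right\rangle_{U_1\times U_2}=\langle v_1,w_1\rangle_{U_1}+\langle v_2,w_2\rangle_{U_2}$. $(T(t))_{t\ge0}$ denotes the semigroup generated by $A$. The extrapolation space $X_{-1}$ is the completion of $X$ with respect to $\|(\lambda-A)^{-1}\cdot\|_X$ for some $\lambda\in\rho(A)$; $A_{-1}$, with domain $X$, is the extension of $A$ that generates the extension of the semigroup to $X_{-1}$. A mild solution is a function $x\in C([0,\infty);X)$ with $x(t)=T(t)x_0+\int_0^tT(t-s)\bigl(B_1F(u_1(s),x(s))+B_2u_2(s)\bigr)\,\mathrm ds$ for all $t\ge0$. A classical solution is a function $x\in C^1([0,\infty);X)$ with $x(0)=x_0$ and $\dot x(t)=A_{-1}x(t)+B_1F(u_1(t),x(t))+B_2u_2(t)$ for almost every $t\ge0$. Under the assumptions of (ii) a unique mild solution exists; under the assumptions of (i) the mild solution is a classical solution. $L^1_{\mathrm{loc}}([0,\infty);V)$ consists of measurable functions integrable on every compact subset of $[0,\infty)$, and $W^{1,1}_{\mathrm{loc}}([0,\infty);V)$ of those $f\in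 L^1_{\mathrm{loc}}([0,\infty);V)$ with weak derivative in $L^1_{\mathrm{loc}}([0,\infty);V)$ (identified with their continuous representatives). *)

(* Defs.v *)
From HB Require Import structures.
From mathcomp Require Export all_boot all_order all_algebra.
From mathcomp Require Export sesquilinear complex.
From mathcomp Require Export all_classical all_reals all_analysis.
Export Order.TTheory GRing.Theory Num.Theory numFieldNormedType.Exports.

Set Implicit Arguments.
Unset Strict Implicit.
Unset Printing Implicit Defensive.

Local Open Scope classical_set_scope.
Local Open Scope complex_scope.
Local Open Scope ring_scope.

(* Complex Hilbert spaces; the inner product is linear in its first argument.
   Positive definiteness follows from [innerE] and the axioms of the norm. *)
HB.mixin Record isHilbert (R : realType) H of CompleteNormedModule R[i] H := {
  inner : H -> H -> R[i];
  inner_linearl : forall y : H, scalar (inner ^~ y);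
  inner_conj : forall x y : H, inner y x = (inner x y)^*;
  innerE : forall x : H, inner x x = `|x| ^+ 2
}.

#[short(type="hilbertType")]
HB.structure Definition Hilbert (R : realType) :=
  { H of CompleteNormedModule R[i] H & isHilbert R H }.

(* Norms take values in R[i]; [rnorm] is the same norm as an element of R. *)
Definition rnorm (R : realType) (V : normedModType R[i]) (v : V) : R :=
  complex.Re `|v|.

Definition inner_pair (R : realType) (U1 U2 : hilbertType R)
  (v w : U1 * U2) : R[i] := inner v.1 w.1 + inner v.2 w.2.

(* The Hilbert space adjoint of a bounded operator [B]: [xget] selects the
   unique [h] with <B g, k> = <g, h> for all [g]. *)
Definition adjoint (R : realType) (G K : hilbertType R) (B : G -> K) (k : K)
  : G := xget 0 [set h | forall g, inner (B g) k = inner g h].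

Section BochnerIntegral.
Variables (R : realType) (V : normedModType R[i]).
Local Notation mu := (@lebesgue_measure R).

Definition simple_function (s : R -> V) : Prop :=
  finite_set (range s) /\ forall v, measurable (s @^-1` [set v]).

Definition simple_integrable (D : set R) (s : R -> V) : Prop :=
  simple_function s /\
  forall v, v != 0 -> (mu (D `&` s @^-1` [set v]) < +oo)%E.

Definition simple_integral (D : set R) (s : R -> V) : V :=
  \sum_(v \in range s) (fine (mu (D `&` s @^-1` [set v])))%:C *: v.

(* The sigma-algebra on R is the Borel one, so that Lebesgue (strong)
   measurability is a.e. approximation by Borel simple functions. *)
Definition strongly_measurable (D : set R) (f : R -> V) : Prop :=
  exists s : nat -> R -> V,
    (forall n, simple_function (s n)) /\
    {ae mu, forall t, D t -> s ^~ t @ \oo --> f t}.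

(* [f] is Bochner integrable over [D], with integral [I]. The approximating
   sequence is required to be Cauchy in L^1, which involves integrals of norms
   of simple functions only. *)
Definition bochner_integral (D : set R) (f : R -> V) (I : V) : Prop :=
  exists s : nat -> R -> V,
    [/\ forall n, simple_integrable D (s n),
        {ae mu, forall t, D t -> s ^~ t @ \oo --> f t},
        forall e : R, 0 < e -> exists N : nat, forall m n : nat,
          (N <= m)%N -> (N <= n)%N ->
          (\int[mu]_(t in D) (rnorm (s m t - s n t))%:E < e%:E)%E
      & simple_integral D (s n) @[n --> \oo] --> I].

Definition bochner_integrable (D : set R) (f : R -> V) : Prop :=
  exists I, bochner_integral D f I.

Definition L1loc (f : R -> V) : Prop :=
  strongly_measurable `[0, +oo[ f /\
  forall K : set R, compact K -> K `<=` `[0, +oo[ -> bochner_integrable K f.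

Definition test_function (phi : R -> R) : Prop :=
  (forall n t, derivable (derive1n n phi) t 1) /\
  exists a b : R, [/\ 0 < a, a <= b & forall t, t \notin `[a, b] -> phi t = 0].

Definition weak_derivative (f g : R -> V) : Prop :=
  forall phi : R -> R, test_function phi ->
  exists I, bochner_integral `[0, +oo[ (fun t => (derive1 phi t)%:C *: f t) I /\
            bochner_integral `[0, +oo[ (fun t => (phi t)%:C *: g t) (- I).

(* Elements of W^{1,1}_loc are represented by their continuous versions. *)
Definition W11loc (f : R -> V) : Prop :=
  [/\ {within `[0, +oo[, continuous f},
      L1loc f
    & exists2 g, L1loc g & weak_derivative f g].

End BochnerIntegral.

(* Derivatives at [t >= 0] of functions on [0, +oo[ (one-sided at 0). *)
Definition is_deriv_ge0 (R : realType) (V : normedModType R[i])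
    (f : R -> V) (t : R) (l : V) : Prop :=
  ((s - t)^-1)%:C *: (f s - f t) @[s --> within `[0, +oo[ t^'] --> l.

Definition is_rderiv_ge0 (R : realType) (f : R -> R) (t l : R) : Prop :=
  (s - t)^-1 * (f s - f t) @[s --> within `[0, +oo[ t^'] --> l.

Section Semigroups.
Variables (R : realType) (X : completeNormedModType R[i]).

(* Only the values [T t] with [0 <= t] are relevant. *)
Definition C0_semigroup (T : R -> X -> X) : Prop :=
  [/\ forall t, 0 <= t -> linear (T t) /\ continuous (T t),
      forall x, T 0 x = x,
      forall s t, 0 <= s -> 0 <= t -> forall x, T (s + t) x = T s (T t x)
    & forall x, T h x @[h --> 0^'+] --> x].

Definition contractive (T : R -> X -> X) : Prop :=
  forall t, 0 <= t -> forall x, `|T t x| <= `|x|.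

(* An unbounded operator is a domain [D] together with a function [A], whose
   values outside [D] are irrelevant. *)
Definition generates (D : set X) (A : X -> X) (T : R -> X -> X) : Prop :=
  [/\ C0_semigroup T,
      forall x, D x <->
        exists l : X, (h^-1)%:C *: (T h x - x) @[h --> 0^'+] --> l
    & forall x, D x -> (h^-1)%:C *: (T h x - x) @[h --> 0^'+] --> A x].

(* lambda is in the resolvent set, with (lambda - A)^-1 = Rl. *)
Definition is_resolvent (D : set X) (A : X -> X) (lambda : R[i]) (Rl : X -> X)
    : Prop :=
  [/\ linear Rl /\ continuous Rl,
      forall x, D (Rl x) /\ lambda *: Rl x - A (Rl x) = x
    & forall x, D x -> Rl (lambda *: x - A x) = x].

End Semigroups.

(* [Xm1], with [j : X -> Xm1], is a realization of the completion of [X] for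
   the norm |(lambda - A)^-1 .|; [Tm1] extends the semigroup [T] generated by
   [(D, A)]; [Am1], with domain the copy [range j] of [X], extends [A] and
   generates [Tm1]. *)
Definition is_extrapolation (R : realType) (X : completeNormedModType R[i])
    (D : set X) (A : X -> X) (T : R -> X -> X)
    (Xm1 : completeNormedModType R[i]) (j : X -> Xm1)
    (Tm1 : R -> Xm1 -> Xm1) (Am1 : Xm1 -> Xm1) : Prop :=
  [/\ linear j /\ closure (range j) = setT,
      exists lambda Rl, is_resolvent D A lambda Rl /\
        forall x, `|j x| = `|Rl x|,
      forall t, 0 <= t -> forall x, Tm1 t (j x) = j (T t x),
      forall x, D x -> Am1 (j x) = j (A x)
    & generates (range j) Am1 Tm1].

Definition bounded_bilinear (R : realType) (U X Z : normedModType R[i])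
    (F : {bilinear U -> X -> Z}) : Prop :=
  exists C : R, 0 < C /\ forall u x, rnorm (F u x) <= C * rnorm u * rnorm x.

Section Systems.
Variables (R : realType) (X U1 U2 Z : hilbertType R).
Variables (B1 : {linear Z -> X}) (B2 : {linear U2 -> X}).
Variable F : {bilinear U1 -> X -> Z}.
Local Notation mu := (@lebesgue_measure R).

Definition output (x : R -> X) (t : R) : U1 * U2 :=
  (adjoint (fun u => F u (x t)) (adjoint B1 (x t)), adjoint B2 (x t)).

Definition mild_solution (T : R -> X -> X) (u1 : R -> U1) (u2 : R -> U2)
    (x0 : X) (x : R -> X) : Prop :=
  {within `[0, +oo[, continuous x} /\
  forall t, 0 <= t -> exists2 I,
    bochner_integral `[0, t]
      (fun s => T (t - s) (B1 (F (u1 s) (x s)) + B2 (u2 s))) I &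
    x t = T t x0 + I.

(* The equation holds in the extrapolation space, in which [X] is embedded
   by [j]. *)
Definition classical_solution (Xm1 : completeNormedModType R[i])
    (j : X -> Xm1) (Am1 : Xm1 -> Xm1) (u1 : R -> U1) (u2 : R -> U2)
    (x0 : X) (x : R -> X) : Prop :=
  exists x' : R -> X,
    [/\ forall t, 0 <= t -> is_deriv_ge0 x t (x' t),
        {within `[0, +oo[, continuous x'},
        x 0 = x0
      & {ae mu, forall t, 0 <= t ->
          j (x' t) =
          Am1 (j (x t)) + j (B1 (F (u1 t) (x t))) + j (B2 (u2 t))}].

End Systems.

(* Main.v *)
Require Import Defs.
From mathcomp Require Import ring lra measurable_realfun.
Set Implicit Arguments.
Unset Strict Implicit.
Unset Printing Implicit Defensive.
Local Open Scope classical_set_scope.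
Local Open Scope complex_scope.
Local Open Scope ring_scope.

(* On a cell [a, b], x(b) = T(b-a) x(a) + J, where J is the integral of
   T(b-s) f(s) and f = B1 F(u1, x) + B2 u2, so contractivity gives
   |x(b)|^2 - |x(a)|^2 <= 2 Re <J, x(b)>. Summing over the cells of a grid of
   [0, t] and refining it, strong continuity of T and dominated convergence give
   |x(t)|^2 - |x(0)|^2 <= 2 Re int <f, x>, and <f, x> = <u, y> by definition of
   the adjoints. For classical solutions, the equation in X_{-1} forces x(t) to
   lie in D(A) for almost every t; there dissipativity of A gives
   Re <x', x> <= Re <f, x>, and both sides are continuous in t. *)

(** A mild solution need not be differentiable, so |x|^2 cannot be differentiated, and the data are
    not regularised either: the cell estimate needs only the variation of constants formula. As J =
    x(b) - T(b-a) x(a), it amounts to 2 Re <T(b-a) x(a), x(b)> <= |x(a)|^2 + |x(b)|^2. The test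
    vector x(b) is constant on the cell, so it can be paired with the integrand; this is why the
    right end point of the cell occurs both in [T] and in [x].

    Bochner integrals are given by approximating simple functions. Bounded real-linear functionals
    turn them into real integrals, and monotonicity, additivity and dominated convergence are
    applied to these alone. That <u, y> is Bochner integrable is part of assertion (ii); it is shown
    by explicit simple functions, which combine L^1 approximations of the inputs with values of the
    path [x] at grid points. Finally, [adjoint] is a choice, meaningful only when a representing
    vector exists; a Riesz theorem provides it. *)

Section ComplexReals.
Variable R : realType.
Implicit Types (a b : R[i]) (r s : R).

Lemma ReD a b : complex.Re (a + b) = complex.Re a + complex.Re b.
Proof. by case: a b => [? ?] [? ?]. Qed.

Lemma ReZ r a : complex.Re (r%:C * a) = r * complex.Re a.
Proof. by case: a => x y /=; rewrite mul0r subr0. Qed.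

Lemma ImD a b : complex.Im (a + b) = complex.Im a + complex.Im b.
Proof. by case: a b => [? ?] [? ?]. Qed.

Lemma ImZ r a : complex.Im (r%:C * a) = r * complex.Im a.
Proof. by case: a => x y /=; rewrite mul0r addr0. Qed.

Lemma real_complexD r s : (r + s)%:C = r%:C + s%:C.
Proof. exact: rmorphD. Qed.

Lemma real_complexM r s : (r * s)%:C = r%:C * s%:C.
Proof. exact: rmorphM. Qed.

Lemma lecR_real r s : (r%:C <= s%:C) = (r <= s).
Proof. by rewrite lecE /= eqxx. Qed.

Lemma ltcR_real r s : (r%:C < s%:C) = (r < s).
Proof. by rewrite ltcE /= eqxx. Qed.

Lemma complex_ge0P a : 0 <= a -> a = (complex.Re a)%:C.
Proof. by case: a => x y; rewrite lecE /= => /andP[/eqP -> _]. Qed.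

End ComplexReals.

(** The order of [R[i]] compares only numbers with equal imaginary parts. Radii of balls for the
    [R[i]]-valued norm can therefore be taken in [R]. *)
Lemma complex_gt0P (R : realType) (a : R[i]) :
  0 < a -> exists2 r : R, 0 < r & a = r%:C.
Proof.
move=> a0; exists (complex.Re a); last exact/complex_ge0P/ltW.
by rewrite -ltcR_real -complex_ge0P // ltW.
Qed.

(** * Norms as real numbers, and convergence in terms of them *)

Section RealNorm.
Variables (R : realType) (V : normedModType R[i]).
Implicit Types (v w : V) (r : R).

Lemma normE v : `|v| = (rnorm v)%:C.
Proof. exact: complex_ge0P. Qed.

Lemma rnorm_ge0 v : 0 <= rnorm v.
Proof. by rewrite -lecR_real -normE normr_ge0. Qed.

Lemma rnorm0 : rnorm (0 : V) = 0.
Proof. by rewrite /rnorm normr0. Qed.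

Lemma rnorm0_eq0 v : rnorm v = 0 -> v = 0.
Proof. by move=> v0; apply/eqP; rewrite -normr_eq0 normE v0. Qed.

Lemma rnormN v : rnorm (- v) = rnorm v.
Proof. by rewrite /rnorm normrN. Qed.

Lemma rnorm_distC v w : rnorm (v - w) = rnorm (w - v).
Proof. by rewrite /rnorm distrC. Qed.

Lemma rnormD v w : rnorm (v + w) <= rnorm v + rnorm w.
Proof.
rewrite -lecR_real real_complexD -!normE ler_normD //.
Qed.

Lemma rnormB v w : rnorm (v - w) <= rnorm v + rnorm w.
Proof. by rewrite -(rnormN w) rnormD. Qed.

Lemma rnorm_dist v w : `|rnorm v - rnorm w| <= rnorm (v - w).
Proof.
rewrite ler_norml; apply/andP; split.
  rewrite lerNl opprB lerBlDr rnorm_distC; apply: le_trans (rnormD _ _).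
  by rewrite subrK.
by rewrite lerBlDr; apply: le_trans (rnormD _ _); rewrite subrK.
Qed.

Lemma rnormZ (c : R[i]) v : rnorm (c *: v) = rnorm (c : R[i]^o) * rnorm v.
Proof.
by apply: (@complexI R); rewrite real_complexM -!normE normrZ; congr (_ * _);
  exact: (@normE R R[i]^o).
Qed.

Lemma rnorm_real r : rnorm (r%:C : R[i]^o) = `|r|.
Proof.
by rewrite /rnorm normc_def /= expr0n addr0 sqrtr_sqr.
Qed.

Lemma rnormZr r v : rnorm (r%:C *: v) = `|r| * rnorm v.
Proof. by rewrite rnormZ rnorm_real. Qed.

Lemma cvg_rnormP (T : Type) (F : set_system T) {FF : Filter F}
    (f : T -> V) (l : V) :
  f @ F --> l <-> forall e : R, 0 < e -> \forall x \near F, rnorm (l - f x) < e.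
Proof.
rewrite cvgrPdist_lt; split=> [fl e e0|fl e e0].
  have e0' : 0 < e%:C by rewrite ltcR_real.
  by apply: filterS (fl _ e0') => x; rewrite normE ltcR_real.
have [r r0 ->] := complex_gt0P e0.
by apply: filterS (fl _ r0) => x; rewrite normE ltcR_real.
Qed.

Lemma cvg_rnorm0P (T : Type) (F : set_system T) {FF : Filter F}
    (f : T -> V) (l : V) :
  f @ F --> l <-> rnorm (f x - l) @[x --> F] --> (0 : R).
Proof.
rewrite cvg_rnormP (@cvgrPdist_lt R R^o); split=> fl e e0;
  apply: filterS (fl _ e0) => x; rewrite sub0r normrN rnorm_distC.
  by rewrite ger0_norm ?rnorm_ge0.
by rewrite ger0_norm ?rnorm_ge0.
Qed.

Lemma cvg_rnorm_squeeze (T : Type) (F : set_system T) {FF : Filter F}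
    (f : T -> V) (l : V) (g : T -> R) :
  (\forall x \near F, rnorm (f x - l) <= g x) -> g @ F --> (0 : R) ->
  f @ F --> l.
Proof.
move=> fg g0; apply/cvg_rnorm0P.
apply: (@squeeze_cvgr _ _ _ _ (fun=> 0) g) => //; last exact: cvg_cst.
by apply: filterS fg => x ->; rewrite rnorm_ge0.
Qed.

Lemma cvg_rnorm (T : Type) (F : set_system T) {FF : Filter F}
    (f : T -> V) (l : V) :
  f @ F --> l -> rnorm (f x) @[x --> F] --> rnorm l.
Proof.
move=> /cvg_rnormP fl; apply/(@cvgrPdist_lt R R^o) => e e0.
by apply: filterS (fl _ e0) => x; apply: le_lt_trans; exact: rnorm_dist.
Qed.

End RealNorm.

(** Continuity at 0 sends a ball of some radius [r] into the unit ball; rescaling a nonzero [v] to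
    norm [r / 2] gives the constant [2 / r]. *)
Lemma continuous_linear_bounded (R : realType) (V W : normedModType R[i])
    (f : V -> W) : linear f -> continuous f ->
  exists C : R, 0 < C /\ forall v, rnorm (f v) <= C * rnorm v.
Proof.
move=> lf cf.
have f0 : f 0 = 0.
  by have := lf (-1) 0 0; rewrite scaleN1r oppr0 add0r scaleN1r addNr.
have fZ (c : R[i]) v : f (c *: v) = c *: f v.
  by have := lf c v 0; rewrite !addr0 f0 addr0.
have /cvg_rnormP/(_ 1 ltr01) := cf 0.
move=> /nbhs_normP[d /= d0 dP].
have [r r0 dE] := complex_gt0P d0; rewrite {}dE {d0} in dP *.
exists (2 / r); split=> [|v]; first by rewrite divr_gt0.
have [->|v0] := eqVneq v 0; first by rewrite f0 !rnorm0 mulr0.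
have nv0 : 0 < rnorm v.
  rewrite lt_neqAle rnorm_ge0 andbT eq_sym; apply: contra v0 => /eqP.
  by move=> /rnorm0_eq0 ->.
pose c := r / 2 / rnorm v.
have c0 : 0 < c by rewrite !divr_gt0.
have : rnorm (c%:C *: v) < r.
  by rewrite rnormZr gtr0_norm // /c divfK ?gt_eqF // ltr_pdivrMr // ltr_pMr // ltr1n.
rewrite -ltcR_real -normE => cv.
have /dP : ball_ Num.norm 0 r%:C (c%:C *: v) by rewrite /= sub0r normrN.
rewrite f0 sub0r rnormN fZ rnormZr gtr0_norm // => /ltW.
rewrite -ler_pdivlMl // => /le_trans; apply.
by rewrite mulr1 /c !invfM !invrK [2 / r]mulrC.
Qed.

(** * The real inner product Re <x, y> *)

Section InnerProduct.
Variables (R : realType) (H : hilbertType R).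
Implicit Types (x y z : H) (r : R).

Definition rinner x y : R := complex.Re (inner x y).

Lemma innerDl x y z : inner (x + y) z = inner x z + inner y z.
Proof. by have := inner_linearl z 1 x y; rewrite scale1r mul1r. Qed.

Lemma inner0l z : inner 0 z = 0.
Proof.
by have := innerDl 0 0 z; rewrite addr0 => /eqP;
  rewrite -subr_eq0 opprD addNKr oppr_eq0 => /eqP.
Qed.

Lemma innerZl (c : R[i]) x z : inner (c *: x) z = c * inner x z.
Proof. by have := inner_linearl z c x 0; rewrite addr0 inner0l addr0. Qed.

Lemma innerBl x y z : inner (x - y) z = inner x z - inner y z.
Proof. by rewrite innerDl -scaleN1r innerZl mulN1r. Qed.

Lemma innerBr x y z : inner z (x - y) = inner z x - inner z y.
Proof.
rewrite inner_conj innerBl [inner z x]inner_conj [inner z y]inner_conj.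
exact: rmorphB.
Qed.

Lemma rinnerC x y : rinner x y = rinner y x.
Proof. by rewrite /rinner inner_conj; case: (inner y x). Qed.

Lemma rinnerDl x y z : rinner (x + y) z = rinner x z + rinner y z.
Proof. by rewrite /rinner innerDl ReD. Qed.

Lemma rinnerZl r x z : rinner (r%:C *: x) z = r * rinner x z.
Proof. by rewrite /rinner innerZl ReZ. Qed.

Lemma rinnerNl x z : rinner (- x) z = - rinner x z.
Proof. by have := rinnerZl (-1) x z; rewrite rmorphN rmorph1 scaleN1r mulN1r. Qed.

Lemma rinnerBl x y z : rinner (x - y) z = rinner x z - rinner y z.
Proof. by rewrite rinnerDl rinnerNl. Qed.

Lemma rinnerDr x y z : rinner z (x + y) = rinner z x + rinner z y.
Proof. by rewrite !(rinnerC z) rinnerDl. Qed.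

Lemma rinnerZr r x z : rinner z (r%:C *: x) = r * rinner z x.
Proof. by rewrite !(rinnerC z) rinnerZl. Qed.

Lemma rinnerNr x z : rinner z (- x) = - rinner z x.
Proof. by rewrite !(rinnerC z) rinnerNl. Qed.

Lemma rinnerBr x y z : rinner z (x - y) = rinner z x - rinner z y.
Proof. by rewrite !(rinnerC z) rinnerBl. Qed.

Lemma rinnerxx x : rinner x x = rnorm x ^+ 2.
Proof.
by rewrite /rinner innerE normE expr2 -real_complexM -expr2.
Qed.

Lemma rnorm_sqrD x y :
  rnorm (x + y) ^+ 2 = rnorm x ^+ 2 + 2 * rinner x y + rnorm y ^+ 2.
Proof.
by rewrite -!rinnerxx rinnerDl !rinnerDr (rinnerC y x) mulr2n mulrDl mul1r !addrA.
Qed.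

Lemma rnorm_sqrB x y :
  rnorm (x - y) ^+ 2 = rnorm x ^+ 2 - 2 * rinner x y + rnorm y ^+ 2.
Proof. by rewrite rnorm_sqrD rinnerNr rnormN mulrN. Qed.

(** The square of the norm of |y| z - |z| y equals 2 |z| |y| (|z| |y| - Re <z, y>) and is
    nonnegative. *)
Lemma cauchy_schwarz x y : `|rinner x y| <= rnorm x * rnorm y.
Proof.
suff le z : rinner z y <= rnorm z * rnorm y.
  rewrite ler_norml le andbT lerNl -rinnerNl -(rnormN x); exact: le.
have [y0|y0] := eqVneq (rnorm y) 0.
  by rewrite y0 mulr0 (rnorm0_eq0 y0) rinnerC /rinner inner0l.
have [z0|z0] := eqVneq (rnorm z) 0.
  by rewrite z0 mul0r (rnorm0_eq0 z0) /rinner inner0l.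
have ngt0 (v : H) : rnorm v != 0 -> 0 < rnorm v.
  by move=> v0; rewrite lt_neqAle eq_sym v0 rnorm_ge0.
have := sqr_ge0 (rnorm ((rnorm y)%:C *: z - (rnorm z)%:C *: y)).
rewrite rnorm_sqrB rinnerZl rinnerZr !rnormZr !ger0_norm ?rnorm_ge0 //.
set a := rnorm z; set b := rnorm y; set c := rinner z y => h.
have ab0 : 0 < a * b by rewrite mulr_gt0 // ngt0.
have : 0 <= 2 * (a * b) * (a * b - c).
  by rewrite (_ : _ * _ = (b * a) ^+ 2 - 2 * (b * (a * c)) + (a * b) ^+ 2) //; ring.
by rewrite pmulr_rge0 ?subr_ge0 // mulr_gt0.
Qed.

Lemma rinner_le x y : rinner x y <= rnorm x * rnorm y.
Proof. exact: le_trans (ler_norm _) (cauchy_schwarz _ _). Qed.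

(** Multiplying [x] by the conjugate of <x, y> makes the inner product the real number |<x, y>|^2;
    the real inequality applies, and one factor |<x, y>| cancels. *)
Lemma rnorm_inner x y : rnorm (inner x y : R[i]^o) <= rnorm x * rnorm y.
Proof.
have [xy0|xy0] := eqVneq (rnorm (inner x y : R[i]^o)) 0.
  by rewrite xy0 mulr_ge0 ?rnorm_ge0.
pose a : R[i] := inner x y.
have := rinner_le ((a^* : R[i]) *: x) y.
rewrite rnormZ /rinner innerZl -/a mulrC -sqr_normc.
have -> : rnorm (a^*%C : R[i]^o) = rnorm (a : R[i]^o) by rewrite /rnorm normcJ.
have aE : `|a| = (rnorm (a : R[i]^o))%:C := @normE R R[i]^o a.
rewrite aE expr2 -real_complexM /= -mulrA ler_pM2l //.
by rewrite lt_neqAle eq_sym xy0 rnorm_ge0.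
Qed.

(** Reduces the complex identity for adjoints to the real inner product. *)
Lemma inner_rinner x y : inner x y = rinner x y -i* rinner ('i%C *: x) y.
Proof.
rewrite /rinner innerZl; case: (inner x y) => a b /=.
by rewrite mul0r mul1r sub0r opprK.
Qed.

End InnerProduct.

Lemma rnorm_cauchy_cvg (R : realType) (V : completeNormedModType R[i])
    (u : nat -> V) :
  (forall e : R, 0 < e -> exists N, forall m n, (N <= m)%N -> (N <= n)%N ->
     rnorm (u m - u n) < e) ->
  exists l : V, u @ \oo --> l.
Proof.
move=> uC; suff /cauchy_cvg uc : @cauchy V (u @ \oo) by exists (lim (u @ \oo)).
apply/cauchy_ballP => e /complex_gt0P[r r0 ->].
have [N uN] := uC _ r0.
exists (u @` [set n | (N <= n)%N], u @` [set n | (N <= n)%N]).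
  by split; exists N => // n /= Nn; exists n.
move=> [_ _] /= [[m Nm <-] [n Nn <-]].
by rewrite -ball_normE /= normE ltcR_real uN.
Qed.

Section InnerLimits.
Variables (R : realType) (H : hilbertType R).

Lemma cvg_rinner (T : Type) (F : set_system T) {FF : Filter F}
    (f g : T -> H) (k l : H) :
  f @ F --> k -> g @ F --> l -> rinner (f x) (g x) @[x --> F] --> rinner k l.
Proof.
move=> fk gl; apply/subr_cvg0.
have fk0 : rnorm (f x - k) @[x --> F] --> 0 by apply/cvg_rnorm0P.
have gl0 : rnorm (g x - l) @[x --> F] --> 0 by apply/cvg_rnorm0P.
apply: norm_cvg0.
apply: (@squeeze_cvgr _ _ _ _ (fun=> 0)
  (fun x => rnorm (f x - k) * rnorm (g x) + rnorm k * rnorm (g x - l))).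
- apply: filterE => x /=; rewrite normr_ge0 /=.
  rewrite (_ : _ - _ = rinner (f x - k) (g x) + rinner k (g x - l)); last first.
    by rewrite rinnerBl rinnerBr; ring.
  by apply: le_trans (ler_normD _ _) _; rewrite lerD ?cauchy_schwarz.
- exact: cvg_cst.
- rewrite [X in _ --> X](_ : 0 = 0 * rnorm l + rnorm k * 0); last by ring.
  apply: cvgD; first by apply: cvgM fk0 _; exact: (cvg_rnorm gl).
  by apply: cvgM => //; exact: cvg_cst.
Qed.

End InnerLimits.

(** * Riesz representation of real-linear functionals, and adjoints *)

Section Riesz.
Variables (R : realType) (H : hilbertType R) (phi : H -> R) (C : R).
Hypothesis phiD : forall x y, phi (x + y) = phi x + phi y.
Hypothesis phiZ : forall r x, phi (r%:C *: x) = r * phi x.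
Hypothesis phi_bound : forall x, `|phi x| <= C * rnorm x.

(** Quadratic energy whose minimiser represents [phi] with respect to [rinner]. *)
Let J (x : H) : R := 2^-1 * rnorm x ^+ 2 - phi x.

Let J_ge x : - (2^-1 * C ^+ 2) <= J x.
Proof.
have := phi_bound x; rewrite /J ler_norml => /andP[_ h].
have := sqr_ge0 (rnorm x - C).
nra.
Qed.

Let m := inf (range J).

Let J_inf : has_inf (range J).
Proof.
split; first by exists (J 0), 0.
by exists (- (2^-1 * C ^+ 2)) => _ [x _ <-]; exact: J_ge.
Qed.

Let J_gem x : m <= J x.
Proof. by apply: ge_inf; [exact: J_inf.2 | exists x]. Qed.

(** In [J x + J y] minus twice the energy of the midpoint the values of [phi] cancel, which leaves
    the left-hand side; the midpoint has energy at least [m]. *)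
Let parallelogram x y : 4^-1 * rnorm (x - y) ^+ 2 <= (J x - m) + (J y - m).
Proof.
have := J_gem ((2^-1)%:C *: (x + y)).
rewrite /J rnormZr exprMn (ger0_norm (_ : 0 <= 2^-1)) // rnorm_sqrB rnorm_sqrD.
by rewrite phiZ phiD; lra.
Qed.

(* A minimising sequence of [J] is Cauchy by the parallelogram identity. *)
Lemma riesz : exists h : H, forall g, phi g = rinner g h.
Proof.
have ex_u n : exists x, J x < m + n.+1%:R^-1.
  have n0 : 0 < n.+1%:R^-1 :> R by rewrite invr_gt0.
  by have [_ [x _ <-] Jx] := inf_adherent n0 J_inf; exists x.
pose u n := proj1_sig (cid (ex_u n)).
have uJ n : J (u n) < m + n.+1%:R^-1 by rewrite /u; case: cid.
have [h uh] : exists h : H, u @ \oo --> h.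
  apply: rnorm_cauchy_cvg => e e0.
  (* Two excess energies below e^2 / 8 give |u p - u q|^2 < e^2 by [parallelogram]. *)
  have /cvgrPdist_lt/(_ (8^-1 * e ^+ 2)) := @cvg_harmonic R.
  case=> [|N _ NP]; first by rewrite mulr_gt0 ?exprn_gt0.
  exists N => p q /NP /= + /NP /=.
  rewrite !sub0r !normrN !gtr0_norm ?invr_gt0 // => hp hq.
  have := parallelogram (u p) (u q); have := uJ p; have := uJ q.
  move=> Jp Jq par.
  rewrite -(@ltr_pXn2r _ 2) ?nnegrE ?rnorm_ge0 ?ltW //.
  move: hp hq Jp Jq par; move: (p.+1%:R^-1) (q.+1%:R^-1) (J (u p)) (J (u q)) => a b c d.
  by move: (rnorm _ ^+ 2) (e ^+ 2) m => x y z; lra.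
exists h => g; rewrite rinnerC.
pose k := rinner h g - phi g.
(* First variation: [J (u n + r g)] is at least [m], hence above [J (u n)] minus 1/(n+1). In the
   limit a quadratic polynomial in [r] is nonnegative, so its linear coefficient [k] must vanish. *)
have main r : 0 <= 2^-1 * r ^+ 2 * rnorm g ^+ 2 + r * k.
  have uk : 2^-1 * r ^+ 2 * rnorm g ^+ 2 + r * (rinner (u n) g - phi g) + n.+1%:R^-1
      @[n --> \oo] --> 2^-1 * r ^+ 2 * rnorm g ^+ 2 + r * k + 0.
    apply: cvgD; last exact: cvg_harmonic.
    apply: cvgD; first exact: cvg_cst.
    apply: cvgM; first exact: cvg_cst.
    apply: cvgB; last exact: cvg_cst.
    by apply: cvg_rinner => //; exact: cvg_cst.
  rewrite addr0 in uk.
  apply: (cvgr_to_ge uk); apply: nearW => n.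
  have := J_gem (u n + r%:C *: g); have := uJ n.
  rewrite /J rnorm_sqrD rnormZr exprMn real_normK ?num_real // rinnerZr phiD phiZ.
  move: (n.+1%:R^-1) m (rnorm (u n) ^+ 2) (rinner (u n) g) (phi (u n)) => a b c d e.
  by move: (rnorm g ^+ 2) (phi g) => x y; lra.
suff k0 : k = 0 by apply/eqP; rewrite eq_sym -subr_eq0 -/k k0.
pose N := rnorm g ^+ 2; have N0 : 0 <= N by rewrite sqr_ge0.
have N1 : 0 < N + 1 by rewrite ltr_pwDr.
(* The polynomial has its minimum at -k/N; the denominator [N + 1] also covers [g = 0] and still
   gives a negative value unless [k = 0]. *)
have := main (- k / (N + 1)); rewrite -/N.
rewrite (_ : _ + _ = - (k / (N + 1)) ^+ 2 * (2^-1 * N + 1)); last by field; lra.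
rewrite mulNr oppr_ge0 => le0.
have : (k / (N + 1)) ^+ 2 == 0.
  by rewrite eq_le sqr_ge0 andbT -(@pmulr_lle0 _ (2^-1 * N + 1)) //; lra.
by rewrite sqrf_eq0 mulf_eq0 invr_eq0 (gt_eqF N1) orbF => /eqP.
Qed.

End Riesz.

(** Riesz for the functional Re <B g, k> gives the real part of the identity; the imaginary part is
    the real part at ['i *: g], as [B] is complex linear. *)
Lemma adjointP (R : realType) (G K : hilbertType R) (B : G -> K) :
  linear B -> (exists C : R, forall g, rnorm (B g) <= C * rnorm g) ->
  forall g k, inner (B g) k = inner g (adjoint B k).
Proof.
move=> lB [C BC] g k; move: g.
suff [h hP] : exists h, forall g, inner (B g) k = inner g h.
  exact: (@xgetPex _ 0 [set h | forall g, inner (B g) k = inner g h] (ex_intro _ h hP)).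
have B0 : B 0 = 0.
  by have := lB (-1) 0 0; rewrite scaleN1r oppr0 add0r scaleN1r addNr.
have BD x y : B (x + y) = B x + B y by have := lB 1 x y; rewrite !scale1r.
have BZ c x : B (c *: x) = c *: B x.
  by have := lB c x 0; rewrite B0 !addr0.
have [||x|h hP] := @riesz _ G (fun g => rinner (B g) k) (C * rnorm k).
- by move=> x y; rewrite BD rinnerDl.
- by move=> r x; rewrite BZ rinnerZl.
- apply: le_trans (cauchy_schwarz _ _) _.
  by rewrite mulrAC ler_wpM2r ?rnorm_ge0.
by exists h => g; rewrite !inner_rinner -BZ !hP.
Qed.

(** * Real integrals of functions known up to null sets *)

Section AeIntegral.
Context d (T : measurableType d) (R : realType) (mu : {measure set T -> \bar R}).
Implicit Types (D : set T) (f g : T -> R) (I : R).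

(* The measurable sets need not be complete, hence the representative [g]. *)
Definition ae_integral D f I : Prop :=
  exists g, [/\ mu.-integrable D (EFin \o g),
    {ae mu, forall t, D t -> f t = g t} & \int[mu]_(t in D) g t = I].

Lemma ae_integral_ae D f g I : {ae mu, forall t, D t -> f t = g t} ->
  ae_integral D f I -> ae_integral D g I.
Proof.
move=> fg [h [ih fh hI]]; exists h; split=> //.
by apply: (filterS2 _ _ fg fh) => t e1 e2 Dt; rewrite -e1 // e2.
Qed.

(** The representatives are ordered only almost everywhere; replacing [h] by the minimum of [h] and
    [h'] keeps its integral and makes the order hold everywhere. *)
Lemma ae_integral_le D f f' I I' : measurable D ->
  {ae mu, forall t, D t -> f t <= f' t} ->
  ae_integral D f I -> ae_integral D f' I' -> I <= I'.
Proof.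
move=> mD ff' [h [ih fh <-]] [h' [ih' fh' <-]].
have mh : measurable_fun D h by apply/measurable_EFinP/(measurable_int _ ih).
have mh' : measurable_fun D h' by apply/measurable_EFinP/(measurable_int _ ih').
have ae_min : ae_eq mu D (EFin \o (h \min h')) (EFin \o h).
  apply: (filterS3 _ _ ff' fh fh') => t e e1 e2 Dt.
  by rewrite /= min_l // -e1 // -e2 // e.
have mm : measurable_fun D (EFin \o (h \min h')).
  by apply/measurable_EFinP; exact: measurable_minr.
have im : mu.-integrable D (EFin \o (h \min h')).
  have := integrableD mD (integrable_norm ih) (integrable_norm ih').
  apply: le_integrable => // t _; rewrite /= lee_fin.
  rewrite [leRHS]ger0_norm ?addr_ge0 //; case: (leP (h t) (h' t)) => _.
    by rewrite lerDl.
  by rewrite lerDr.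
have -> : \int[mu]_(t in D) h t = \int[mu]_(t in D) (h \min h') t.
  rewrite /Rintegral; congr fine; apply: ae_eq_integral => //.
    exact: measurable_int ih.
  exact: ae_eq_sym.
by apply: le_Rintegral => // t _ /=; rewrite ge_min lexx orbT.
Qed.

Lemma ae_integral_unique D f I I' : measurable D ->
  ae_integral D f I -> ae_integral D f I' -> I = I'.
Proof.
move=> mD fI fI'; apply: le_anti.
by apply/andP; split; apply: (@ae_integral_le D f f) => //; exact: (aeW mu).
Qed.

Lemma ae_integralZ D f I c : measurable D ->
  ae_integral D f I -> ae_integral D (fun t => c * f t) (c * I).
Proof.
move=> mD [h [ih fh <-]]; exists (fun t => c * h t).
split; last exact: RintegralZl.
  exact: (integrableZl mD c ih).
by apply: filterS fh => t e1 Dt; rewrite e1.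
Qed.

Lemma ae_integral_null D f : measurable D -> mu D = 0%E -> ae_integral D f 0.
Proof.
move=> mD D0; exists (fun=> 0); split.
- exact: integrable0.
- exists D; split => // t /= /not_implyP[] //.
- by rewrite Rintegral_cst // mul0r.
Qed.

Lemma ae_integral_subset D D' f I : measurable D -> measurable D' ->
  D' `<=` D -> ae_integral D f I -> exists I', ae_integral D' f I'.
Proof.
move=> mD mD' sD [h [ih fh _]]; exists (\int[mu]_(t in D') h t), h; split=> //.
  exact: (integrableS mD mD' sD).
by apply: filterS fh => t e1 /sD.
Qed.

Lemma ae_integral_setU D D' f I I' : measurable D -> measurable D' ->
  [disjoint D & D'] -> ae_integral D f I -> ae_integral D' f I' ->
  ae_integral (D `|` D') f (I + I').
Proof.
move=> mD mD' dD [h [ih fh <-]] [h' [ih' fh' <-]].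
pose k t := if t \in D then h t else h' t.
have kh : {in D, h =1 k} by move=> t tD; rewrite /k tD.
have kh' : {in D', h' =1 k}.
  move=> t; rewrite inE => tD'; rewrite /k; case: ifP => //; rewrite inE => tD.
  have /disj_setPS dP := dD.
  by have := dP t (conj tD tD').
have ik : mu.-integrable D (EFin \o k).
  by apply: eq_integrable ih => // t tD; rewrite /= kh.
have ik' : mu.-integrable D' (EFin \o k).
  by apply: eq_integrable ih' => // t tD; rewrite /= kh'.
have iu : mu.-integrable (D `|` D') (EFin \o k).
  have /integrableP[mk ifk] := ik; have /integrableP[mk' ifk'] := ik'.
  have mkU : measurable_fun (D `|` D') (EFin \o k) by apply/measurable_funU.
  apply/integrableP; split=> //; rewrite ge0_integral_setU //.
    exact: lte_add_pinfty.
  exact: measurableT_comp.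
exists k; split=> //; last first.
  rewrite Rintegral_setU //; congr (_ + _); apply: eq_Rintegral => t tD.
    by rewrite kh.
  by rewrite kh'.
apply: (filterS2 _ _ fh fh') => t e1 e2 [Dt|D't].
  by rewrite -kh ?inE // e1.
by rewrite -kh' ?inE // e2.
Qed.

(** Integrability on [D'] comes by restriction, the value from additivity and uniqueness on the
    union. This isolates the integral over one grid cell. *)
Lemma ae_integral_setD D D' f I I' : measurable D -> measurable D' ->
  [disjoint D & D'] -> ae_integral D f I -> ae_integral (D `|` D') f I' ->
  ae_integral D' f (I' - I).
Proof.
move=> mD mD' dD fI fI'.
have mU : measurable (D `|` D') by exact: measurableU.
have [J fJ] := ae_integral_subset mU mD' (@subsetUr _ D D') fI'.
by rewrite (ae_integral_unique mU fI' (ae_integral_setU mD mD' dD fI fJ)) addrC addKr.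
Qed.

(** The upper limit of the measurable representatives is measurable and agrees with [f] almost
    everywhere, so it represents [f]. *)
Lemma ae_integral_dominated D (f_ : nat -> T -> R) f g (I_ : nat -> R) J :
  measurable D -> (forall n, ae_integral D (f_ n) (I_ n)) ->
  ae_integral D g J ->
  (forall n, {ae mu, forall t, D t -> `|f_ n t| <= g t}) ->
  {ae mu, forall t, D t -> f_ ^~ t @ \oo --> f t} ->
  exists2 I, ae_integral D f I & I_ @ \oo --> I.
Proof.
move=> mD fI [g' [ig gg' _]] fg ff.
have [h_ hP] := choice fI.
have ih n : mu.-integrable D (EFin \o h_ n) by case: (hP n).
have mh n : measurable_fun D (h_ n) by apply/measurable_EFinP/(measurable_int _ (ih n)).
have fh : {ae mu, forall t, forall n, D t -> f_ n t = h_ n t}.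
  by apply/ae_foralln => n; case: (hP n).
have hI n : \int[mu]_(t in D) h_ n t = I_ n by case: (hP n).
have {}fg : {ae mu, forall t, forall n, D t -> `|f_ n t| <= g t} by exact/ae_foralln.
pose h t := fine (limn_esup (fun n => (h_ n t)%:E)).
have mh' : measurable_fun D h.
  apply: measurableT_comp => //; apply: measurable_fun_limn_esup => n.
  exact/measurable_EFinP.
have hcvg t : D t -> (forall n, D t -> f_ n t = h_ n t) ->
    (D t -> f_ ^~ t @ \oo --> f t) -> f t = h t.
  move=> Dt e1 /(_ Dt) e2; rewrite /h.
  have : (h_ n t)%:E @[n --> \oo] --> (f t)%:E.
    apply: cvg_EFin; first exact: nearW.
    rewrite (_ : fine \o _ = f_ ^~ t) //.
    by apply/funext => n /=; rewrite e1.
  by move=> /cvg_limn_einf_sup[_ ->].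
have [] := @dominated_convergence _ _ _ mu D mD (fun n => EFin \o h_ n) (EFin
  \o h) (EFin \o g').
- by move=> n; exact/measurable_EFinP.
- exact/measurable_EFinP.
- apply: (filterS2 _ _ fh ff) => t e1 e2 Dt /=.
  rewrite -hcvg //; apply: cvg_EFin; first exact: nearW.
  rewrite (_ : fine \o _ = f_ ^~ t); first exact: e2.
  by apply/funext => n /=; rewrite e1.
- exact: ig.
- apply: (filterS3 _ _ fh fg gg') => t e1 e2 e3 n Dt.
  by rewrite /= lee_fin -e1 // -e3 // e2.
move=> ihh _ hlim; exists (\int[mu]_(t in D) h t).
  exists h; split=> //.
  by apply: (filterS2 _ _ fh ff) => t e1 e2 Dt; exact: hcvg.
rewrite (_ : I_ = fun n => \int[mu]_(t in D) h_ n t);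
  last by apply/funext => n; rewrite hI.
apply: fine_cvg; rewrite fineK //; exact: integrable_fin_num.
Qed.

Lemma measurable_fun_limn_einf D (u : nat -> T -> \bar R) :
  (forall n, measurable_fun D (u n)) ->
  measurable_fun D (fun t => limn_einf (u ^~ t)).
Proof.
move=> mu_; apply: measurableT_comp => //.
by apply: (@measurable_fun_limn_esup _ _ _ _ (fun n t => - u n t)%E) => n;
  exact: measurableT_comp.
Qed.

(* Fatou's lemma bounds the L^1 distance from the limit to [p n]. *)
Lemma ae_integral_cauchy D (p : nat -> T -> R) f :
  measurable D -> (forall n, mu.-integrable D (EFin \o p n)) ->
  (forall e, 0 < e -> exists N, forall m n, (N <= m)%N -> (N <= n)%N ->
    (\int[mu]_(t in D) `|p m t - p n t|%:E <= e%:E)%E) ->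
  {ae mu, forall t, D t -> p ^~ t @ \oo --> f t} ->
  exists2 I, ae_integral D f I & \int[mu]_(t in D) p n t @[n --> \oo] --> I.
Proof.
move=> mD ip pC pf.
have mp n : measurable_fun D (p n) by apply/measurable_EFinP/(measurable_int _ (ip n)).
pose h t := fine (limn_esup (fun n => (p n t)%:E)).
have mh : measurable_fun D h.
  apply: measurableT_comp => //; apply: measurable_fun_limn_esup => n.
  exact/measurable_EFinP.
have fh : {ae mu, forall t, D t -> f t = h t}.
  apply: filterS pf => t + Dt => /(_ Dt) pft; rewrite /h.
  have : (p n t)%:E @[n --> \oo] --> (f t)%:E by apply: cvg_EFin => //; exact: nearW.
  by move=> /cvg_limn_einf_sup[_ ->].
have mhp n : measurable_fun D (fun t => `|h t - p n t|%:E).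
  by apply/measurable_EFinP; apply: measurableT_comp => //; exact: measurable_funB.
have main e : 0 < e -> exists N, forall n, (N <= n)%N ->
    (\int[mu]_(t in D) `|h t - p n t|%:E <= e%:E)%E.
  move=> /pC[N pN]; exists N => n Nn.
  have mpn m : measurable_fun D (fun t => `|p m t - p n t|%:E).
    by apply/measurable_EFinP; apply: measurableT_comp => //; exact: measurable_funB.
  have -> : (\int[mu]_(t in D) `|h t - p n t|%:E =
      \int[mu]_(t in D) limn_einf (fun m => `|p m t - p n t|%:E))%E.
    apply: ae_eq_integral => //; first exact: measurable_fun_limn_einf.
    apply: (filterS2 _ _ pf fh) => t + + Dt => /(_ Dt) pft /(_ Dt) fht.
    have : `|p m t - p n t|%:E @[m --> \oo] --> `|f t - p n t|%:E.
      apply: cvg_EFin; first exact: nearW.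
      by apply: cvg_norm; apply: cvgB => //; exact: cvg_cst.
    by move=> /cvg_limn_einf_sup[-> _]; rewrite fht.
  apply: le_trans (fatou _ mD mpn _) _; first by move=> m t _; rewrite lee_fin.
  rewrite limn_einf_lim; apply: lime_le; first exact: is_cvg_einfs.
  (* The infimum over the indices from [k] on is at most the term at [maxn N k], to which the Cauchy
     estimate applies. *)
  apply: nearW => k; apply: le_trans (pN (maxn N k) n (leq_maxl _ _) Nn).
  by apply: ereal_inf_lbound; exists (maxn N k) => //=; exact: leq_maxr.
have [N0 hN0] := main 1 ltr01.
have ihp : mu.-integrable D (EFin \o (fun t => h t - p N0 t)).
  apply/integrableP; split; first by apply/measurable_EFinP; exact: measurable_funB.
  exact: le_lt_trans (hN0 _ (leqnn _)) (ltry _).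
have ih : mu.-integrable D (EFin \o h).
  apply: eq_integrable (integrableD mD ihp (ip N0)) => // t _.
  by rewrite /= -EFinD subrK.
exists (\int[mu]_(t in D) h t); first by exists h.
apply/cvgrPdist_le => e e0; have [N hN] := main _ e0.
exists N => // n /= Nn.
rewrite -RintegralB //; apply: le_trans (le_normr_Rintegral _ _) _ => //.
  exact: (integrableB mD ih (ip n)).
rewrite -lee_fin fineK; last first.
  apply: integrable_fin_num => //; apply: integrable_norm.
  exact: (integrableB mD ih (ip n)).
exact: hN.
Qed.

End AeIntegral.

#[export] Instance lebesgue_ae_filter (R : realType) :
  Filter (nbhs (almost_everywhere (@lebesgue_measure R))) :=
  ae_filter_ringOfSetsType _.

(** * Simple functions, and real functionals of Bochner integrals *)

Section SimpleFunctions.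
Variables (R : realType).
Local Notation mu := (@lebesgue_measure R).
(* The Borel sets as they occur in the type of [lebesgue_measure]; those of [R]
   are convertible, but carry another display. *)
Local Notation borel D := (@measurable _ (measurableTypeR R) D).

(** The preimage is a finite union of level sets, so [Y] can be any set. Hence simple functions may
    be composed with arbitrary maps. *)
Lemma simple_function_measurable (V : normedModType R[i]) (s : R -> V) (Y : set V) :
  simple_function s -> measurable (s @^-1` Y).
Proof.
move=> [fs ms].
rewrite (_ : s @^-1` Y = \bigcup_(v in range s `&` Y) s @^-1` [set v]); last first.
  apply/seteqP; split => t /=; first by move=> Yt; exists (s t).
  by move=> [v [_ Yv] /= ->].
by apply: fin_bigcup_measurable => //; exact: finite_setIl.
Qed.

Lemma simple_function_comp (V W : normedModType R[i]) (s : R -> V) (phi : V -> W) :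
  simple_function s -> simple_function (phi \o s).
Proof.
move=> ss; split; last by move=> v;
  exact: (simple_function_measurable (phi @^-1` [set v]) ss).
apply: sub_finite_set (finite_image phi ss.1).
by move=> _ [t _ <-]; exists (s t) => //; exists t.
Qed.

Lemma simple_function_pair (V W : normedModType R[i]) (s : R -> V) (s' : R -> W) :
  simple_function s -> simple_function s' ->
  simple_function (fun t => (s t, s' t) : V * W).
Proof.
move=> [fs ms] [fs' ms']; split.
  apply: sub_finite_set (finite_setX fs fs').
  by move=> _ [t _ <-]; split => /=; exists t.
move=> [v w]; rewrite (_ : _ @^-1` _ = s @^-1` [set v] `&` s' @^-1` [set w]).
  exact: measurableI.
by apply/seteqP; split => t /= [-> ->].
Qed.

(** Finite measure of the support, rather than of each nonzero level set, passes easily to pairs and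
    to images under maps that fix 0. *)
Lemma simple_integrableP (D : set R) (V : normedModType R[i]) (s : R -> V) :
  measurable D ->
  simple_integrable D s <->
  simple_function s /\ (mu (D `&` s @^-1` [set v : V | v != 0%R]) < +oo)%E.
Proof.
move=> mD; split=> [[ss fs]|[ss fs]]; split=> //; last first.
  move=> v v0; apply: le_lt_trans fs; apply: le_measure; rewrite ?inE.
  - by apply: measurableI => //; exact: simple_function_measurable.
  - by apply: measurableI => //; exact: simple_function_measurable.
  - by move=> t [Dt /= ->].
pose A := range s `&` [set v : V | v != 0%R].
have fA : finite_set A by exact/finite_setIl/ss.1.
apply: (@le_lt_trans _ _ (\sum_(v \in A) mu (D `&` s @^-1` [set v]))%E).
  apply: content_sub_fsum => //.
  - by move=> v _; apply: measurableI => //; exact: simple_function_measurable.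
  - by apply: measurableI => //; exact: simple_function_measurable.
  - by move=> t [Dt st]; exists (s t) => //; split => //; exists t.
rewrite fsbig_finite //= big_seq; apply: lte_sum_pinfty => v.
by rewrite in_fset_set // inE => -[_ v0]; exact: fs.
Qed.

Lemma simple_integrable_comp (D : set R) (V W : normedModType R[i]) (s : R -> V)
    (phi : V -> W) :
  measurable D -> phi 0 = 0 -> simple_integrable D s ->
  simple_integrable D (phi \o s).
Proof.
move=> mD phi0 /(simple_integrableP _ mD)[ss fs]; apply/simple_integrableP => //.
split; first exact: simple_function_comp.
apply: le_lt_trans fs; apply: le_measure; rewrite ?inE.
- apply: measurableI => //; apply: simple_function_measurable.
  exact: simple_function_comp.
- by apply: measurableI => //; exact: simple_function_measurable.
- move=> t /= [Dt pst]; split=> //; apply: contra_neq pst => ->; exact: phi0.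
Qed.

Lemma simple_integrable_pair (D : set R) (V W : normedModType R[i]) (s : R -> V)
    (s' : R -> W) :
  measurable D -> simple_integrable D s -> simple_integrable D s' ->
  simple_integrable D (fun t => (s t, s' t) : V * W).
Proof.
move=> mD /(simple_integrableP _ mD)[ss fs] /(simple_integrableP _ mD)[ss' fs'].
have mm (U : normedModType R[i]) (u : R -> U) Y : simple_function u ->
    measurable (D `&` u @^-1` Y).
  by move=> su; apply: measurableI => //; exact: simple_function_measurable.
apply/simple_integrableP => //; split; first exact: simple_function_pair.
apply: (@le_lt_trans _ _ (mu ((D `&` s @^-1` [set v : V | v != 0%R]) `|`
    (D `&` s' @^-1` [set v : W | v != 0%R])))).
  apply: le_measure; rewrite ?inE.
  - by apply: (mm (V * W)%type); exact: simple_function_pair.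
  - by apply: measurableU; exact: mm.
  - move=> t /= [Dt]; have [->|?] := eqVneq (s t) 0; last by left.
    by have [->|?] := eqVneq (s' t) 0; [rewrite eqxx|right].
apply: (@le_lt_trans _ _ (mu (D `&` s @^-1` [set v : V | v != 0%R]) +
  mu (D `&` s' @^-1` [set v : W | v != 0%R]))%E); last exact: lte_add_pinfty.
by apply: measureU2; exact: mm.
Qed.

Lemma simple_measurable_fun (D : set R) (V : normedModType R[i]) (s : R -> V)
    (phi : V -> R) :
  borel D -> simple_function s -> measurable_fun (D : set (measurableTypeR R))
    (phi \o s).
Proof.
move=> mD ss _ Y mY; apply: measurableI => //.
exact: (simple_function_measurable (phi @^-1` Y) ss).
Qed.

Lemma simple_fun_integral (D : set R) (V : normedModType R[i]) (s : R -> V)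
    (phi : V -> R) :
  borel D -> phi 0 = 0 -> simple_integrable D s ->
  mu.-integrable D (EFin \o (phi \o s)) /\
  \int[mu]_(t in D) phi (s t) =
    \sum_(v \in range s) fine (mu (D `&` s @^-1` [set v])) * phi v.
Proof.
move=> mD phi0 [ss fs]; have finr := ss.1.
pose h (r : seq V) t := \sum_(v <- r) phi v * \1_(s @^-1` [set v]) t.
have sE : phi \o s = h (finmap.enum_fset (fset_set (range s))).
  apply/funext => t; rewrite /h (bigD1_seq (s t)) ?finmap.fset_uniq //=; last first.
    have := in_fset_set finr (s t); rewrite mem_set; first exact.
    by exists t.
  rewrite indicE mem_set //= mulr1 big1 ?addr0 // => v vt.
  rewrite indicE memNset ?mulr0 //= => stv; move: vt; by rewrite stv eqxx.
have ii v : mu.-integrable D (EFin \o (fun t => phi v * \1_(s @^-1` [set v]) t)) /\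
    \int[mu]_(t in D) (phi v * \1_(s @^-1` [set v]) t) =
    fine (mu (D `&` s @^-1` [set v])) * phi v.
  have mv : borel (s @^-1` [set v]) by exact: ss.2.
  (* The zero level set may have infinite measure; its term vanishes because [phi 0 = 0]. *)
  have [->|v0] := eqVneq v 0.
    rewrite phi0 mulr0; split.
      rewrite (_ : _ \o _ = cst 0%E); first exact: integrable0.
      by apply/funext => t /=; rewrite mul0r.
    under eq_Rintegral do rewrite mul0r.
    by rewrite Rintegral_cst // mul0r.
  have iv : mu.-integrable D (EFin \o \1_(s @^-1` [set v])).
    apply/integrableP; split; first by apply/measurable_EFinP; exact: measurable_indic.
    under eq_integral do rewrite /= ger0_norm //.
    by rewrite integral_indic // setIC; exact: fs.
  split; first exact: (integrableZl mD (phi v) iv).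
  by rewrite RintegralZl // mulrC /Rintegral integral_indic // setIC.
rewrite fsbig_finite //= -[fun t => phi (s t)]/(phi \o s) sE.
elim: (finmap.enum_fset _) => [|v r [IH1 IH2]].
  rewrite big_nil /h; split.
    rewrite (_ : _ \o _ = cst 0%E); first exact: integrable0.
    by apply/funext => t /=; rewrite big_nil.
  under eq_Rintegral do rewrite big_nil.
  by rewrite Rintegral_cst // mul0r.
have hE : h (v :: r) = (fun t => phi v * \1_(s @^-1` [set v]) t + h r t).
  by apply/funext => t; rewrite /h big_cons.
have [i1 i2] := ii v; rewrite big_cons hE; split.
  exact: (integrableD mD i1 IH1).
by rewrite RintegralD // i2 IH2.
Qed.

Definition L1_cauchy (V : normedModType R[i]) (D : set R) (s : nat -> R -> V) :=
  forall e : R, 0 < e -> exists N : nat, forall m n : nat,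
    (N <= m)%N -> (N <= n)%N ->
    (\int[mu]_(t in D) (rnorm (s m t - s n t))%:E < e%:E)%E.

Section BochnerLimits.
Variables (V : normedModType R[i]) (D : set R) (s : nat -> R -> V) (f : R -> V).
Hypothesis mD : borel D.
Hypothesis simple_s : forall n, simple_integrable D (s n).
Hypothesis sf : {ae mu, forall t, D t -> s ^~ t @ \oo --> f t}.
Hypothesis sC : L1_cauchy D s.

(** The Lipschitz bound carries the Cauchy condition and the convergence over to [phi \o s n].
    Lipschitz maps, rather than linear ones, include the norm. *)
Lemma ae_integral_lipschitz (phi : V -> R) (L : R) :
  phi 0 = 0 -> (forall v w, `|phi v - phi w| <= L * rnorm (v - w)) ->
  exists2 J, ae_integral mu D (phi \o f) J &
    \int[mu]_(t in D) phi (s n t) @[n --> \oo] --> J.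
Proof.
move=> phi0 phiL.
apply: (@ae_integral_cauchy _ _ _ mu D (fun n => phi \o s n)) => //.
- by move=> n; exact: (simple_fun_integral mD phi0 (simple_s n)).1.
(* [K] dominates [L] and is positive whatever the sign of [L]. *)
- move=> e e0; pose K := `|L| + 1; have K0 : 0 < K by rewrite ltr_wpDl.
  have [N sN] := sC (divr_gt0 e0 K0); exists N => m n Nm Nn.
  have ss := simple_function_pair (simple_s m).1 (simple_s n).1.
  apply: (@le_trans _ _ (\int[mu]_(t in D) (K%:E * (rnorm (s m t - s n t))%:E))%E).
    apply: ge0_le_integral => //.
    - by apply/measurable_EFinP;
      exact: (simple_measurable_fun (fun v : V * V => `|phi v.1 - phi v.2|) mD ss).
    - by apply/measurable_EFinP;
      exact: (simple_measurable_fun (fun v : V * V => K * rnorm (v.1 - v.2)) mD ss).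
    - move=> t _; rewrite -EFinM lee_fin; apply: le_trans (phiL _ _) _.
      by rewrite ler_wpM2r ?rnorm_ge0 // ler_wpDr // ler_norm.
  rewrite ge0_integralZl //; last 3 first.
  - by apply/measurable_EFinP;
    exact: (simple_measurable_fun (fun v : V * V => rnorm (v.1 - v.2)) mD ss).
  - by move=> t _; rewrite lee_fin rnorm_ge0.
  - by rewrite lee_fin ltW.
  by rewrite muleC -lee_pdivlMr // -EFinM ltW // sN.
- apply: filterS sf => t + Dt => /(_ Dt) sft.
  apply/subr_cvg0; apply: norm_cvg0.
  apply: (@squeeze_cvgr _ _ _ _ (fun=> 0) (fun n => L * rnorm (s n t - f t))).
  + by apply: filterE => n /=; rewrite normr_ge0 phiL.
  + exact: cvg_cst.
  + rewrite -[X in _ --> X](mulr0 L); apply: cvgM; first exact: cvg_cst.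
    exact/cvg_rnorm0P.
Qed.

Section RealLinear.
Variables (phi : V -> R) (C : R).
Hypothesis phiD : forall v w, phi (v + w) = phi v + phi w.
Hypothesis phiZ : forall r v, phi (r%:C *: v) = r * phi v.
Hypothesis phi_bound : forall v, `|phi v| <= C * rnorm v.

Lemma real_linear0 : phi 0 = 0.
Proof. by have := phiZ 0 0; rewrite scaler0 mul0r. Qed.

Lemma real_linear_lipschitz v w : `|phi v - phi w| <= C * rnorm (v - w).
Proof.
have phiN : phi (- w) = - phi w.
  by have := phiZ (-1) w; rewrite rmorphN rmorph1 scaleN1r mulN1r.
by apply: le_trans (phi_bound _); rewrite phiD phiN.
Qed.

Lemma real_linear_simple_integral (u : R -> V) : simple_integrable D u ->
  phi (simple_integral D u) = \int[mu]_(t in D) phi (u t).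
Proof.
move=> su; rewrite (simple_fun_integral mD real_linear0 su).2 /simple_integral.
have fu : finite_set (range u) := su.1.1.
rewrite !fsbig_finite //=.
rewrite (big_morph phi phiD real_linear0).
by apply: eq_bigr => v _; rewrite phiZ.
Qed.

(** The numbers [phi (simple_integral D (s n))] tend to [phi I] by continuity of [phi], and to the
    integral of [phi \o f] because they are the integrals of [phi \o s n]. *)
Lemma ae_integral_real_linear I : simple_integral D (s n) @[n --> \oo] --> I ->
  ae_integral mu D (phi \o f) (phi I).
Proof.
move=> sI; have [J fJ sJ] := ae_integral_lipschitz real_linear0 real_linear_lipschitz.
have {}sJ : phi (simple_integral D (s n)) @[n --> \oo] --> J.
  apply: cvg_trans sJ; apply: near_eq_cvg; apply: nearW => n.
  by rewrite real_linear_simple_integral.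
suff phiI : phi (simple_integral D (s n)) @[n --> \oo] --> phi I.
  by rewrite (cvg_unique (@Rhausdorff R) phiI sJ).
apply/subr_cvg0; apply: norm_cvg0.
apply: (@squeeze_cvgr _ _ _ _ (fun=> 0) (fun n => C * rnorm (simple_integral D
  (s n) - I))).
- by apply: filterE => n /=; rewrite normr_ge0 real_linear_lipschitz.
- exact: cvg_cst.
- rewrite -[X in _ --> X](mulr0 C); apply: cvgM; first exact: cvg_cst.
  exact/cvg_rnorm0P.
Qed.

End RealLinear.
End BochnerLimits.

Lemma bochner_real_linear (V : normedModType R[i]) (D : set R) (f : R -> V) I phi C :
  borel D -> bochner_integral D f I ->
  (forall v w, phi (v + w) = phi v + phi w) ->
  (forall r v, phi (r%:C *: v) = r * phi v) ->
  (forall v, `|phi v| <= C * rnorm v) ->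
  ae_integral mu D (phi \o f) (phi I).
Proof.
move=> mD [s [ss sf sC sI]] phiD phiZ phiC.
exact: (ae_integral_real_linear mD ss sf sC phiD phiZ phiC).
Qed.

End SimpleFunctions.

(** * Bochner integrability of scalar products of two factors *)

Section BochnerProducts.
Variables (R : realType).
Local Notation mu := (@lebesgue_measure R).
Local Notation borel D := (@measurable _ (measurableTypeR R) D).

Lemma Re_le_rnorm (z : R[i]^o) : `|complex.Re z| <= rnorm z.
Proof. by rewrite -lecR_real; apply: le_trans (normc_ge_Re z) _;
  rewrite -(@normE R R[i]^o). Qed.

Lemma Im_le_rnorm (z : R[i]^o) : `|complex.Im z| <= rnorm z.
Proof.
rewrite (_ : rnorm z = rnorm (('i%C : R[i]^o) *: z)); last first.
  by rewrite rnormZ /rnorm normc_def /= expr0n expr1n add0r sqrtr1 mul1r.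
apply: le_trans (Re_le_rnorm _); rewrite [_ *: _]mulrC ReiNIm normrN.
exact: lexx.
Qed.

Lemma rnorm_le_ReIm (z : R[i]^o) : rnorm z <= `|complex.Re z| + `|complex.Im z|.
Proof.
case: z => a b; rewrite [X in rnorm X](_ : _ = (a%:C : R[i]^o) + (b%:C :
  R[i]^o) * 'i%C); last first.
  by apply/eqP; rewrite eq_complex /= !(mulr0, mul0r, mulr1) subrr !addr0 add0r !eqxx.
apply: le_trans (rnormD _ _) _; rewrite rnorm_real lerD2l.
rewrite [rnorm _](_ : _ = rnorm ((b%:C : R[i]^o) *: ('i%C : R[i]^o))) // rnormZ
  rnorm_real.
by rewrite /rnorm normc_def /= expr0n expr1n add0r sqrtr1 mulr1.
Qed.

(** What is missing is a limit of the simple integrals. Their real and imaginary parts are real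
    integrals, which converge by [ae_integral_lipschitz]. *)
Lemma bochner_integrable_complex (D : set R) (s : nat -> R -> R[i]^o) (f : R ->
  R[i]^o) :
  borel D -> (forall n, simple_integrable D (s n)) ->
  {ae mu, forall t, D t -> s ^~ t @ \oo --> f t} -> L1_cauchy D s ->
  bochner_integrable D f.
Proof.
move=> mD ss sf sC.
have ReDo (v w : R[i]^o) : complex.Re (v + w) = complex.Re v + complex.Re w := ReD v w.
have ReZo r (v : R[i]^o) : complex.Re (r%:C *: v) = r * complex.Re v := ReZ r v.
have ImDo (v w : R[i]^o) : complex.Im (v + w) = complex.Im v + complex.Im w := ImD v w.
have ImZo r (v : R[i]^o) : complex.Im (r%:C *: v) = r * complex.Im v := ImZ r v.
have Re1 (v : R[i]^o) : `|complex.Re v| <= 1 * rnorm v by rewrite mul1r Re_le_rnorm.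
have Im1 (v : R[i]^o) : `|complex.Im v| <= 1 * rnorm v by rewrite mul1r Im_le_rnorm.
have [a _ sa] := ae_integral_lipschitz mD ss sf sC (real_linear0 ReZo)
  (real_linear_lipschitz ReDo ReZo Re1).
have [b _ sb] := ae_integral_lipschitz mD ss sf sC (real_linear0 ImZo)
  (real_linear_lipschitz ImDo ImZo Im1).
exists (a +i* b), s; split=> //.
apply: (@cvg_rnorm_squeeze _ _ _ _ _ _ _
  (fun n => `|\int[mu]_(t in D) complex.Re (s n t) - a| + `|\int[mu]_(t in D)
    complex.Im (s n t) - b|)).
  apply: nearW => n; apply: le_trans (rnorm_le_ReIm _) _.
  rewrite -(real_linear_simple_integral mD ReDo ReZo (ss n)).
  rewrite -(real_linear_simple_integral mD ImDo ImZo (ss n)).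
  by case: (simple_integral D (s n)) => p q.
rewrite -[X in _ --> X](addr0 0); apply: cvgD.
  rewrite -[X in _ --> X](normr0 R); apply: cvg_norm.
  by apply/subr_cvg0.
rewrite -[X in _ --> X](normr0 R); apply: cvg_norm.
by apply/subr_cvg0.
Qed.

Section Cauchy.
Variables (D : set R).
Hypothesis mD : borel D.

Lemma simple_integrable_rnorm (V : normedModType R[i]) (s : R -> V) :
  simple_integrable D s -> mu.-integrable D (EFin \o (fun t => rnorm (s t))).
Proof. by move=> ss; exact: (simple_fun_integral mD (rnorm0 V) ss).1. Qed.

Lemma simple_integrableB (V : normedModType R[i]) (s s' : R -> V) :
  simple_integrable D s -> simple_integrable D s' ->
  simple_integrable D (fun t => s t - s' t).
Proof.
move=> ss ss'.
apply: (@simple_integrable_comp _ _ (V * V)%type _ _ (fun p : V * V => p.1 - p.2) _ _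
  (simple_integrable_pair mD ss ss')) => //.
exact: subrr.
Qed.

Lemma L1_cauchyP (V : normedModType R[i]) (s : nat -> R -> V) :
  (forall n, simple_integrable D (s n)) ->
  L1_cauchy D s <-> forall e : R, 0 < e -> exists N : nat, forall m n : nat,
    (N <= m)%N -> (N <= n)%N -> \int[mu]_(t in D) rnorm (s m t - s n t) < e.
Proof.
move=> ss.
have E m n : (\int[mu]_(t in D) (rnorm (s m t - s n t))%:E)%E =
    (\int[mu]_(t in D) rnorm (s m t - s n t))%:E.
  rewrite fineK //; apply: integrable_fin_num => //.
  exact: (simple_integrable_rnorm (simple_integrableB (ss m) (ss n))).
by split=> sC e /sC[N sN]; exists N => m n Nm Nn; have := sN m n Nm Nn;
  rewrite E lte_fin.
Qed.

Lemma L1_cauchy_bounded (V : normedModType R[i]) (s : nat -> R -> V) :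
  (forall n, simple_integrable D (s n)) -> L1_cauchy D s ->
  exists N S, forall n, (N <= n)%N -> \int[mu]_(t in D) rnorm (s n t) <= S.
Proof.
move=> ss /(L1_cauchyP ss)/(_ _ ltr01)[N sN].
exists N, (1 + \int[mu]_(t in D) rnorm (s N t)) => n Nn.
have iB := simple_integrable_rnorm (simple_integrableB (ss n) (ss N)).
have iN := simple_integrable_rnorm (ss N).
apply: (@le_trans _ _ (\int[mu]_(t in D) (rnorm (s n t - s N t) + rnorm (s N t)))).
  apply: le_Rintegral => //; first exact: simple_integrable_rnorm.
    exact: (integrableD mD iB iN).
  by move=> t _; apply: le_trans (rnormD _ _); rewrite subrK.
by rewrite RintegralD // lerD2r ltW // sN.
Qed.

Lemma rnorm_pair_le (V W : normedModType R[i]) (p : (V * W)%type) :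
  rnorm p <= rnorm p.1 + rnorm p.2.
Proof.
rewrite -lecR_real real_complexD -!normE prod_normE.
by rewrite /Order.max; case: ifP => _; rewrite ?lerDl ?lerDr ?normr_ge0.
Qed.

(** Gives both inputs one common approximating sequence, from which [bochner_integrable_product] can
    start. *)
Lemma bochner_integrable_pair (V W : normedModType R[i]) (f : R -> V) (g : R -> W) :
  bochner_integrable D f -> bochner_integrable D g ->
  exists s : nat -> R -> (V * W)%type,
   [/\ forall n, simple_integrable D (s n),
     {ae mu, forall t, D t -> s ^~ t @ \oo --> (f t, g t)} & L1_cauchy D s].
Proof.
move=> [I [s [ss sf sC _]]] [J [s' [ss' sf' sC' _]]].
have sp n := simple_integrable_pair mD (ss n) (ss' n).
exists (fun n t => (s n t, s' n t)); split => //.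
  apply: (filterS2 _ _ sf sf') => t e1 e2 Dt.
  by apply: cvg_pair; [exact: e1 | exact: e2].
apply/L1_cauchyP => // e e0.
have e20 : 0 < e / 2 by rewrite divr_gt0.
have [N sN] := (L1_cauchyP ss).1 sC _ e20.
have [N' sN'] := (L1_cauchyP ss').1 sC' _ e20.
exists (maxn N N') => m n; rewrite !geq_max => /andP[Nm Nm'] /andP[Nn Nn'].
have i1 := simple_integrable_rnorm (simple_integrableB (ss m) (ss n)).
have i2 := simple_integrable_rnorm (simple_integrableB (ss' m) (ss' n)).
apply: (@le_lt_trans _ _ (\int[mu]_(t in D) (rnorm (s m t - s n t) + rnorm (s'
  m t - s' n t)))).
  apply: le_Rintegral => //.
  - exact: (simple_integrable_rnorm (simple_integrableB (sp m) (sp n))).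
  - exact: (integrableD mD i1 i2).
  - by move=> t _; exact: rnorm_pair_le.
by rewrite RintegralD // (splitr e) ltrD // (sN, sN').
Qed.

(** The factor [f] is approximated in L^1 by [w n], the bounded factor [x] uniformly by [y n]; the
    Lipschitz bound makes [G (w n) (y n)] an approximating sequence. The weight [rnorm a'] is
    integrable, which suffices against a uniformly small [rnorm (b - b')]. *)
Lemma bochner_integrable_product (V W : normedModType R[i])
    (G : V -> W -> R[i]^o) (L M : R) (w : nat -> R -> V) (f : R -> V)
    (y : nat -> R -> W) (x : R -> W) :
  0 <= L -> (forall b, G 0 b = 0) ->
  (forall a b a' b', rnorm b <= M -> rnorm b' <= M ->
    rnorm (G a b - G a' b') <= L * (rnorm (a - a') + rnorm a' * rnorm (b - b'))) ->
  (forall n, simple_integrable D (w n)) ->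
  {ae mu, forall t, D t -> w ^~ t @ \oo --> f t} -> L1_cauchy D w ->
  (forall n, simple_function (y n)) ->
  (forall n t, D t -> rnorm (y n t) <= M) -> (forall t, D t -> rnorm (x t) <= M) ->
  (forall e, 0 < e -> exists N, forall n, (N <= n)%N -> forall t, D t ->
    rnorm (y n t - x t) < e) ->
  bochner_integrable D (fun t => G (f t) (x t)).
Proof.
move=> L0 G0 GL sw wf wC sy yM xM yx.
have sG n : simple_integrable D (fun t => G (w n t) (y n t)).
  have sp := simple_function_pair (sw n).1 (sy n).
  have sGn : simple_function (fun t => G (w n t) (y n t)).
    exact: (@simple_function_comp _ _ _ _ (fun p : (V * W)%type => G p.1 p.2) sp).
  apply/simple_integrableP => //; split=> //.
  (* Since [G 0 b = 0], the support lies in that of [w n]; nothing is asked of the support of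
     [y n]. *)
  have /(simple_integrableP _ mD)[_] := sw n.
  apply: le_lt_trans; apply: le_measure; rewrite ?inE.
  - by apply: measurableI => //; exact: simple_function_measurable.
  - by apply: measurableI => //; apply: simple_function_measurable; exact: (sw n).1.
  - by move=> t /= [Dt Gt]; split=> //; apply: contra_neq Gt => ->.
apply: (@bochner_integrable_complex D (fun n t => G (w n t) (y n t))) => //.
  apply: filterS wf => t + Dt => /(_ Dt) wft.
  have yxt : y ^~ t @ \oo --> x t.
    apply/cvg_rnormP => e /yx[N yN]; exists N => // n /= Nn.
    by rewrite rnorm_distC yN.
  apply: (@cvg_rnorm_squeeze _ _ _ _ _ _ _
    (fun n => L * (rnorm (w n t - f t) + rnorm (f t) * rnorm (y n t - x t)))).
    by apply: nearW => n; apply: GL; [exact: yM|exact: xM].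
  rewrite [X in _ --> X](_ : 0 = L * (0 + rnorm (f t) * 0));
    last by rewrite mulr0 addr0 mulr0.
  apply: cvgM; first exact: cvg_cst.
  apply: cvgD; first exact/cvg_rnorm0P.
  by apply: cvgM; [exact: cvg_cst | exact/cvg_rnorm0P].
apply/L1_cauchyP => // e e0.
have [N0 [S hS]] := L1_cauchy_bounded sw wC.
(* With errors below [e / K] for [w] and, through [x], below twice that for [y], the total is at
   most L (1 + 2 |S|) e / K < e, where [S] bounds the L^1 norms of [w n]. *)
pose K := (L + 1) * (`|S| + 1) * 4.
have K0 : 0 < K by rewrite !mulr_gt0 // ltr_wpDl.
have eK0 : 0 < e / K by rewrite divr_gt0.
have [N1 wN] := (L1_cauchyP sw).1 wC _ eK0.
have [N2 yN] := yx _ eK0.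
exists (maxn N0 (maxn N1 N2)) => m n.
rewrite !geq_max => /and3P[Nm Nm1 Nm2] /and3P[Nn Nn1 Nn2].
have i1 := simple_integrable_rnorm (simple_integrableB (sw m) (sw n)).
have i2 := simple_integrable_rnorm (sw n).
have i2' := integrableZl mD (2 * (e / K)) i2.
have i3 := integrableD mD i1 i2'.
apply: (@le_lt_trans _ _ (\int[mu]_(t in D)
    (L * (rnorm (w m t - w n t) + 2 * (e / K) * rnorm (w n t))))).
  apply: le_Rintegral => //.
  - exact: (simple_integrable_rnorm (simple_integrableB (sG m) (sG n))).
  - exact: (integrableZl mD L i3).
  - move=> t Dt; apply: le_trans (GL _ _ _ _ (yM m t Dt) (yM n t Dt)) _.
    rewrite ler_wpM2l // lerD2l mulrC ler_wpM2r ?rnorm_ge0 //.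
    rewrite -(subrK (x t) (y m t)) -addrA; apply: le_trans (rnormD _ _) _.
    by rewrite mulr2n mulrDl mul1r lerD // ltW ?yN // rnorm_distC yN.
rewrite RintegralZl // RintegralD // RintegralZl //.
have := wN _ _ Nm1 Nn1; have := hS _ Nn.
set a := Rintegral _ _ _; set b := Rintegral _ _ _ => aS be.
have aS' : a <= `|S| by exact: le_trans aS (ler_norm _).
have eE : e = e / K * K by rewrite divfK // gt_eqF.
have h1 : L * (b + 2 * (e / K) * a) <= L * (e / K + 2 * (e / K) * `|S|).
  apply: ler_wpM2l => //; apply: lerD; first exact: ltW.
  by apply: ler_wpM2l => //; rewrite mulr_ge0 // ltW.
apply: le_lt_trans h1 _; rewrite [ltRHS]eE /K.
move: (e / _) eK0 (normr_ge0 S) => c c0 S0.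
have -> : L * (c + 2 * c * `|S|) = c * (L * (1 + 2 * `|S|)) by ring.
by rewrite ltr_pM2l //; nra.
Qed.

End Cauchy.
End BochnerProducts.

(** * Continuous paths on compact sets *)

Section ContinuousPaths.
Variables (R : realType) (V : normedModType R[i]).
Implicit Types (x : R -> V) (K : set R).

Lemma within_rnormP x K s : {within K, continuous x} -> K s ->
  forall e : R, 0 < e -> exists2 d : R, 0 < d &
    forall r, K r -> `|r - s| < d -> rnorm (x r - x s) < e.
Proof.
move=> /subspace_continuousP xK Ks e e0.
have /cvg_rnormP/(_ _ e0) := xK _ Ks.
move=> /nbhs_normP[d /= d0 dP]; exists d => // r Kr rs.
by rewrite rnorm_distC; apply: dP => //=; rewrite distrC.
Qed.

(** After halving, a radius valid at one point works at all nearby points; near-covering compactness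
    merges these local radii into one for [K]. *)
Lemma compact_unif_continuous x K : compact K -> {within K, continuous x} ->
  forall e : R, 0 < e -> exists2 d : R, 0 < d &
    forall r s, K r -> K s -> `|r - s| < d -> rnorm (x r - x s) < e.
Proof.
move=> /compact_near_coveringP cK xK e e0.
pose P (d s : R) := K s -> forall r, K r -> `|r - s| < d -> rnorm (x r - x s) < e.
have : \forall d \near (0 : R)^'+, K `<=` P d.
  apply: cK => s Ks.
  have e20 : 0 < e / 2 by rewrite divr_gt0.
  have [d d0 dP] := within_rnormP xK Ks e20.
  have d20 : 0 < d / 2 by rewrite divr_gt0.
  exists ([set s' | `|s - s'| < d / 2], [set d' | d' < d / 2]) => /=.
    split; first exact: nbhsx_ballx.
    exact: nbhs_right_lt.
  move=> [s' d'] /= [ss' dd'] Ks' r Kr rs'.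
  rewrite -(subrKA (x s)); apply: le_lt_trans (rnormD _ _) _.
  rewrite (splitr e) ltrD //; last first.
    by rewrite rnorm_distC; apply: dP => //;
      rewrite distrC (lt_trans ss') // ltr_pdivrMr // ltr_pMr // ltr1n.
  apply: dP => //; rewrite -(subrKA s'); apply: le_lt_trans (ler_normD _ _) _.
  by rewrite (splitr d) ltrD ?(lt_trans rs') // distrC.
move=> [d /= d0 dP]; exists (d / 2); first by rewrite divr_gt0.
move=> r s Kr Ks; apply: dP => //; last by rewrite /= divr_gt0.
by rewrite /= sub0r normrN gtr0_norm ?divr_gt0 // ltr_pdivrMr // ltr_pMr // ltr1n.
Qed.

Lemma compact_rnorm_bounded x K : compact K -> {within K, continuous x} ->
  exists M : R, 0 <= M /\ forall s, K s -> rnorm (x s) <= M.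
Proof.
move=> /compact_near_coveringP cK xK.
pose P (M s : R) := K s -> rnorm (x s) <= M.
have : \forall M \near +oo, K `<=` P M.
  apply: cK => s Ks.
  have [d d0 dP] := within_rnormP xK Ks ltr01.
  exists ([set s' | `|s - s'| < d], [set M | rnorm (x s) + 1 < M]) => /=.
    split; first exact: nbhsx_ballx.
    by apply: nbhs_pinfty_gt; rewrite num_real.
  move=> [s' M] /= [ss' sM] Ks'; apply/ltW/(lt_trans _ sM).
  rewrite -ltrBlDl; apply: le_lt_trans (dP _ Ks' _); last by rewrite distrC.
  exact: le_trans (ler_norm _) (rnorm_dist _ _).
case=> M [_ MP]; exists (`|M| + 1); split=> [|s Ks]; first by rewrite addr_ge0.
by apply: (MP (`|M| + 1)) => //; rewrite ltr_pwDr // ler_norm.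
Qed.

End ContinuousPaths.

(** * Grids, and step functions that sample a path *)

Section Grids.
Variable R : realType.

(* The right end point of the cell of the grid [a] that contains [s]. *)
Fixpoint cell_end (a : nat -> R) (k : nat) (s : R) : R :=
  if k is k'.+1 then if a k' < s then a k'.+1 else cell_end a k' s else a 0.

Lemma cell_end_itv (a : nat -> R) N i s : nondecreasing_seq a ->
  (i < N)%N -> a i < s <= a i.+1 -> cell_end a N s = a i.+1.
Proof.
move=> na; elim: N => // N IH;
  rewrite ltnS leq_eqVlt => /predU1P[->|iN] /andP[ais sai] /=.
  by rewrite ais.
by rewrite ltNge (le_trans sai) /= ?IH ?ais // na.
Qed.

(** Cells are open on the left, so [a 0] lies in none and receives the default value. *)
Lemma cell_end0 (a : nat -> R) N : nondecreasing_seq a -> cell_end a N (a 0) = a 0.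
Proof. by move=> na; elim: N => //= N ->; rewrite ltNge na. Qed.

Lemma grid_cell (a : nat -> R) N s : a 0 < s <= a N ->
  exists2 i, (i < N)%N & a i < s <= a i.+1.
Proof.
elim: N => [|N IH] /andP[a0s sa].
  by have := lt_le_trans a0s sa; rewrite ltxx.
have [saN|aNs] := leP s (a N); last by exists N; rewrite // aNs sa.
by have [|i iN ?] := IH; [rewrite a0s|exists i => //; exact: ltn_trans iN _].
Qed.

Lemma simple_function_if (V : normedModType R[i]) (s s' : R -> V) (b : R -> bool) :
  measurable [set t | b t] -> simple_function s -> simple_function s' ->
  simple_function (fun t => if b t then s t else s' t).
Proof.
move=> mb [fs ms] [fs' ms']; split.
  have : finite_set (range s `|` range s') by rewrite finite_setU.
  apply: sub_finite_set => _ [t _ <-]; case: (b t); [left|right]; by exists t.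
move=> v.
rewrite (_ : _ @^-1` _ = ([set t | b t] `&` s @^-1` [set v]) `|`
   (~` [set t | b t] `&` s' @^-1` [set v])).
  by apply: measurableU; apply: measurableI => //; exact: measurableC.
apply/seteqP; split => t /=; first by case: (b t) => ?; [left|right].
by case: (b t) => -[[? ?]|[? ?]].
Qed.

Lemma simple_function_cst (V : normedModType R[i]) (v : V) :
  simple_function (fun _ : R => v).
Proof.
split; first by apply: sub_finite_set (finite_set1 v) => _ [t _ <-].
move=> w; have [->|wv] := eqVneq w v.
  by rewrite (_ : _ @^-1` _ = setT) //; apply/seteqP; split.
rewrite (_ : _ @^-1` _ = set0) //; apply/seteqP; split => // t /= e.
by rewrite e eqxx in wv.
Qed.

(** Supplies the simple functions that approximate the path uniformly. *)
Lemma simple_function_cell_end (V : normedModType R[i]) (x : R -> V) a N :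
  simple_function (fun s => x (cell_end a N s)).
Proof.
elim: N => [|N IH] /=; first exact: simple_function_cst.
rewrite (_ : (fun s => _) =
  (fun s => if a N < s then x (a N.+1) else x (cell_end a N s))); last first.
  by apply/funext => s; case: ifP.
apply: simple_function_if => //; last exact: simple_function_cst.
rewrite (_ : [set t | _] = `]a N, +oo[%classic); first exact: measurable_itv.
by apply/seteqP; split => t /=; rewrite in_itv /= andbT.
Qed.

End Grids.

Section PairNorm.
Variables (R : realType) (V W : normedModType R[i]).

Lemma rnorm_fst_le (p : (V * W)%type) : rnorm p.1 <= rnorm p.
Proof.
rewrite -lecR_real -!normE prod_normE /Order.max.
by case: ifP => // /ltW.
Qed.

Lemma rnorm_snd_le (p : (V * W)%type) : rnorm p.2 <= rnorm p.
Proof.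
rewrite -lecR_real -!normE prod_normE /Order.max; case: ifP => // /negbT.
by rewrite !normE ltcR_real lecR_real -leNgt.
Qed.

End PairNorm.

(** * The forcing term and its relation to the output *)

Section BilinearInput.
Variables (R : realType) (X U1 U2 Z : hilbertType R).
Variables (B1 : {linear Z -> X}) (B2 : {linear U2 -> X}).
Variable F : {bilinear U1 -> X -> Z}.
Hypotheses (hB1 : continuous B1) (hB2 : continuous B2) (hF : bounded_bilinear F).

Definition input (v : U1 * U2) (y : X) : X := B1 (F v.1 y) + B2 v.2.

Lemma input0 y : input 0 y = 0.
Proof. by rewrite /input /= linear0l !linear0 addr0. Qed.

(** The difference is an increment of the controls at the state [y] plus an increment of the state
    under the controls [v']. The 1 in [1 + rnorm y] accounts for [B2], whose contribution does not
    grow with the state. *)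
Lemma input_lipschitz : exists K : R, 0 < K /\ forall v y v' y',
  rnorm (input v y - input v' y') <=
    K * (1 + rnorm y) * rnorm (v - v') + K * rnorm v' * rnorm (y - y').
Proof.
have [c1 [c10 B1c]] := continuous_linear_bounded (@linearP _ _ _ _ B1) hB1.
have [c2 [c20 B2c]] := continuous_linear_bounded (@linearP _ _ _ _ B2) hB2.
have [C [C0 FC]] := hF.
exists (c1 * C + c2); split; first by rewrite addr_gt0 // mulr_gt0.
move=> v y v' y'.
have -> : input v y - input v' y' =
    (B1 (F (v.1 - v'.1) y) + B2 (v.2 - v'.2)) + B1 (F v'.1 (y - y')).
  rewrite /input linearBl linearBr /= !raddfB /=.
  set p := B1 _; set q := B2 _; set r := B1 _; set s := B2 _; set z := B1 _.
  by rewrite [RHS]addrAC subrKA opprD addrACA.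
apply: le_trans (rnormD _ _) _; apply: lerD.
  apply: le_trans (rnormD _ _) _.
  have h1 := le_trans (B1c _) (ler_wpM2l (ltW c10) (FC (v.1 - v'.1) y)).
  have h2 := B2c (v.2 - v'.2).
  have h3 : rnorm (v.1 - v'.1) <= rnorm (v - v') := rnorm_fst_le (v - v').
  have h4 : rnorm (v.2 - v'.2) <= rnorm (v - v') := rnorm_snd_le (v - v').
  have y0 := rnorm_ge0 y; have v0 := rnorm_ge0 (v - v').
  apply: (le_trans (lerD h1 h2)).
  have P0 : 0 < c1 * C by rewrite mulr_gt0.
  move: (rnorm (v - v')) (rnorm (v.1 - _)) (rnorm (v.2 - _)) (rnorm y) h3 h4 y0
    v0 => n a b r an bn r0 n0.
  have := mulr_ge0 (mulr_ge0 (ltW P0) r0) (_ : 0 <= n - a); rewrite subr_ge0 => /(_ an).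
  have := mulr_ge0 (ltW c20) (_ : 0 <= n - b); rewrite subr_ge0 => /(_ bn).
  have := mulr_ge0 (ltW P0) n0; have := mulr_ge0 (mulr_ge0 (ltW c20) n0) r0.
  by nra.
apply: le_trans (B1c _) _.
apply: le_trans (ler_wpM2l (ltW c10) (FC _ _)) _.
rewrite !mulrA ler_wpM2r ?rnorm_ge0 //.
have P0 : 0 < c1 * C by rewrite mulr_gt0.
apply: ler_pM; rewrite ?rnorm_ge0 ?(ltW P0) //; last exact: rnorm_fst_le.
by rewrite lerDl ltW.
Qed.

Lemma input_bounded (K : R) : (forall v y v' y',
  rnorm (input v y - input v' y') <=
    K * (1 + rnorm y) * rnorm (v - v') + K * rnorm v' * rnorm (y - y')) ->
  forall v y, rnorm (input v y) <= K * (1 + rnorm y) * rnorm v.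
Proof.
by move=> KP v y; have := KP v y 0 y;
  rewrite input0 !subr0 subrr (rnorm0 X) mulr0 addr0.
Qed.

Lemma inner_pair_output (x : R -> X) (t : R) (v : U1 * U2) :
  inner_pair v (output B1 B2 F x t) = inner (input v (x t)) (x t).
Proof.
have [c1 [c10 B1c]] := continuous_linear_bounded (@linearP _ _ _ _ B1) hB1.
have [c2 [c20 B2c]] := continuous_linear_bounded (@linearP _ _ _ _ B2) hB2.
have [C [C0 FC]] := hF.
rewrite /inner_pair /output /input /= innerDl; congr (_ + _).
  rewrite -(adjointP (B := fun u => F u (x t))).
  - by rewrite -(adjointP (@linearP _ _ _ _ B1)) //; exists c1.
  - by move=> c a b; rewrite linearPl.
  - by exists (C * rnorm (x t)) => g; rewrite mulrAC.
by rewrite -(adjointP (@linearP _ _ _ _ B2)) //; exists c2.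
Qed.

End BilinearInput.

(** * Mild solutions, with the forcing frozen as a function [f] of time *)

Section MildSolutions.
Variables (R : realType) (X : hilbertType R) (T : R -> X -> X).
Hypotheses (hT : C0_semigroup T) (cT : contractive T).
Local Notation mu := (@lebesgue_measure R).

Lemma semigroup_rnorm t y : 0 <= t -> rnorm (T t y) <= rnorm y.
Proof. by move=> t0; rewrite -lecR_real -!normE cT. Qed.

(** Strong continuity is given along positive times, while the distance to the next node may be 0;
    there [T 0] is the identity. *)
Lemma semigroup_cvg0 y (h : nat -> R) : (forall n, 0 <= h n) -> h @ \oo --> 0 ->
  T (h n) y @[n --> \oo] --> y.
Proof.
have [_ T0 _ /(_ y) Ty] := hT; move=> h0 hcvg.
apply/cvg_rnormP => e e0.
have /cvg_rnormP/(_ _ e0)[d /= d0 dP] := Ty.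
have /cvgrPdist_lt/(_ _ d0) := hcvg; apply: filterS => n hn.
have [->|hn0] := eqVneq (h n) 0; first by rewrite T0 subrr rnorm0.
by apply: dP => //; rewrite lt_neqAle eq_sym hn0 h0.
Qed.

Lemma semigroup_linear t : 0 <= t -> linear (T t).
Proof. by move=> t0; have [/(_ t t0)[]] := hT. Qed.

Lemma semigroupD t x y : 0 <= t -> T t (x + y) = T t x + T t y.
Proof. by move=> t0; have := semigroup_linear t0 1 x y; rewrite !scale1r. Qed.

Lemma semigroup0 t : 0 <= t -> T t 0 = 0.
Proof.
move=> t0; have := semigroupD 0 0 t0.
by rewrite addr0 => /eqP; rewrite eq_sym addrC -subr_eq0 addrK => /eqP.
Qed.

Lemma semigroupZ t c x : 0 <= t -> T t (c *: x) = c *: T t x.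
Proof.
by move=> t0; have := semigroup_linear t0 c x 0; rewrite semigroup0 // !addr0.
Qed.

Lemma bochner_rinner (D : set R) (g : R -> X) (I y : X) :
  @measurable _ (measurableTypeR R) D -> bochner_integral D g I ->
  ae_integral mu D (fun s => rinner (g s) y) (rinner I y).
Proof.
move=> mD gI.
apply: (@bochner_real_linear _ _ _ _ _ (fun z => rinner z y) (rnorm y) mD gI).
- by move=> v w; rewrite rinnerDl.
- by move=> r v; rewrite rinnerZl.
- by move=> v; rewrite mulrC cauchy_schwarz.
Qed.

Variables (f x : R -> X) (x0 : X).
Hypothesis mild : forall t, 0 <= t -> exists2 I,
  bochner_integral `[0, t] (fun s => T (t - s) (f s)) I & x t = T t x0 + I.

(** The integral [I] over the null set [0, 0], tested against itself, gives |I|^2 = 0. *)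
Lemma mild_initial : x 0 = x0.
Proof.
have [I TI ->] := mild (lexx 0); have [_ -> _ _] := hT.
suff /rnorm0_eq0 -> : rnorm I = 0 by rewrite addr0.
have m0 : @measurable _ (measurableTypeR R) `[0, 0]%classic by exact: measurable_itv.
have h := bochner_rinner I m0 TI.
have h0 : ae_integral mu `[0, 0] (fun s => rinner (T (0 - s) (f s)) I) 0.
  by apply: ae_integral_null; [exact: m0|rewrite set_itv1;
    exact: lebesgue_measure_set1].
by have /eqP := ae_integral_unique m0 h h0; rewrite rinnerxx sqrf_eq0 => /eqP.
Qed.

Lemma itv0_setU (a b : R) : 0 <= a -> a <= b ->
  `[0, b]%classic = `[0, a] `|` `]a, b].
Proof.
move=> a0 ab; by rewrite -itv_bndbnd_setU // bnd_simp.
Qed.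

Lemma itv0_disjoint (a b : R) : [disjoint `[0, a]%classic & `]a, b]%classic].
Proof.
apply/disj_setPS => t /= []; rewrite !in_itv /= => /andP[_ ta] /andP[at_ _].
by have := lt_le_trans at_ ta; rewrite ltxx.
Qed.

Lemma mild_increment a b : 0 <= a -> a <= b ->
  exists2 J, ae_integral mu `]a, b] (fun s => rinner (T (b - s) (f s)) (x b)) J &
    rnorm (x b) ^+ 2 - rnorm (x a) ^+ 2 <= 2 * J.
Proof.
move=> a0 ab; have b0 := le_trans a0 ab.
have ba0 : 0 <= b - a by rewrite subr_ge0.
have [Ib bIb xb] := mild b0; have [Ia bIa xa] := mild a0.
have m0a : @measurable _ (measurableTypeR R) `[0, a]%classic by exact: measurable_itv.
have m0b : @measurable _ (measurableTypeR R) `[0, b]%classic by exact: measurable_itv.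
have mab : @measurable _ (measurableTypeR R) `]a, b]%classic by exact: measurable_itv.
have hb := bochner_rinner (x b) m0b bIb.
(* T(b-a) T(a-s) = T(b-s) moves the formula at time [a] to time [b], so that both integrals have the
   same integrand. *)
have ha : ae_integral mu `[0, a] (fun s => rinner (T (b - s) (f s)) (x b))
    (rinner (T (b - a) Ia) (x b)).
  apply: ae_integral_ae (bochner_real_linear (phi := fun z => rinner (T (b - a)
    z) (x b)) (C := rnorm (x b)) m0a bIa _ _ _).
  - apply: aeW => s /=; rewrite in_itv /= => /andP[s0 sa].
    have [_ _ Tadd _] := hT; rewrite -Tadd ?subr_ge0 //.
    by rewrite subrKA.
  - by move=> v w; rewrite semigroupD // rinnerDl.
  - by move=> r v; rewrite semigroupZ // rinnerZl.
  - move=> v; apply: le_trans (cauchy_schwarz _ _) _.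
    by rewrite mulrC ler_wpM2l ?rnorm_ge0 // semigroup_rnorm.
rewrite (itv0_setU a0 ab) in hb.
exists (rinner Ib (x b) - rinner (T (b - a) Ia) (x b)).
  exact: (ae_integral_setD m0a mab (itv0_disjoint a b) ha hb).
rewrite -rinnerBl.
(* The terms with [x0] cancel, since T(b) x0 = T(b-a) T(a) x0. *)
have -> : Ib - T (b - a) Ia = x b - T (b - a) (x a).
  rewrite xa semigroupD //; have [_ _ Tadd _] := hT; rewrite -Tadd // subrK.
  by rewrite {1}xb [_ + Ib]addrC opprD addrA addrK.
rewrite rinnerBl rinnerxx.
have Tx := semigroup_rnorm (x a) ba0.
have := rinner_le (T (b - a) (x a)) (x b).
have := sqr_ge0 (rnorm (x a) - rnorm (x b)).
have := rnorm_ge0 (x b); have := rnorm_ge0 (x a).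
nra.
Qed.

Lemma mild_grid (a : nat -> R) N : nondecreasing_seq a -> a 0 = 0 ->
  exists2 J, ae_integral mu `[0, a N]
      (fun s => rinner (T (cell_end a N s - s) (f s)) (x (cell_end a N s))) J &
    rnorm (x (a N)) ^+ 2 - rnorm x0 ^+ 2 <= 2 * J.
Proof.
move=> na a0.
have a_ge0 i : 0 <= a i by rewrite -a0 na.
elim: N => [|N [J hJ xJ]].
  exists 0; last by rewrite a0 mild_initial subrr mulr0.
  apply: ae_integral_null; first exact: measurable_itv.
  by rewrite a0 set_itv1; exact: lebesgue_measure_set1.
have [J' hJ' xJ'] := mild_increment (a_ge0 N) (na _ _ (leqnSn N)).
exists (J + J'); last first.
  by rewrite mulrDr -(subrKA (rnorm (x (a N)) ^+ 2)) addrC lerD.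
rewrite (itv0_setU (a_ge0 N) (na _ _ (leqnSn N))).
apply: ae_integral_setU => //; try exact: measurable_itv.
- exact: itv0_disjoint.
- apply: ae_integral_ae hJ; apply: aeW => s /=; rewrite in_itv /= => /andP[_ saN].
  by rewrite ltNge saN.
- apply: ae_integral_ae hJ'; apply: aeW => s /=; rewrite in_itv /= => /andP[aNs _].
  by rewrite aNs.
Qed.

End MildSolutions.

(** * Uniform grids of [0, t] and the passage to the limit *)

Section UniformGrid.
Variables (R : realType) (t : R).
Hypothesis t0 : 0 <= t.

(** With [n.+1] cells the mesh t/(n+1) is defined for every [n], and the last node has index
    [n.+1]. *)
Definition uniform_grid n (i : nat) : R := t * i%:R / n.+1%:R.

Lemma uniform_grid_mono n : nondecreasing_seq (uniform_grid n).
Proof.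
move=> i k ik; rewrite /uniform_grid ler_wpM2r ?invr_ge0 //.
by rewrite ler_wpM2l // ler_nat.
Qed.

Lemma uniform_grid0 n : uniform_grid n 0 = 0.
Proof. by rewrite /uniform_grid mulr0 mul0r. Qed.

Lemma uniform_grid_end n : uniform_grid n n.+1 = t.
Proof. by rewrite /uniform_grid mulfK. Qed.

Definition next_node n s := cell_end (uniform_grid n) n.+1 s.

Lemma next_nodeP n s : 0 <= s <= t ->
  s <= next_node n s <= t /\ next_node n s - s <= t * n.+1%:R^-1.
Proof.
have mono := @uniform_grid_mono n.
move=> /andP[]; rewrite le_eqVlt => /predU1P[<-|s0] st; rewrite /next_node.
  rewrite -[X in cell_end _ _ X](uniform_grid0 n) cell_end0 // uniform_grid0.
  by rewrite lexx t0 subrr mulr_ge0 ?invr_ge0.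
have [|i iN /andP[ais sai]] := @grid_cell _ (uniform_grid n) n.+1 s.
  by rewrite uniform_grid0 uniform_grid_end s0.
rewrite (cell_end_itv mono iN) ?ais // sai -[X in _ <= X](uniform_grid_end n) mono //.
split=> //; apply: le_trans (lerB (lexx _) (ltW ais)) _.
by rewrite /uniform_grid -mulrBl -mulrBr -natr1 addrAC subrr add0r mulr1.
Qed.

Lemma cvg_mesh : t * n.+1%:R^-1 @[n --> \oo] --> 0.
Proof.
rewrite -[X in _ --> X](mulr0 t); apply: cvgM; first exact: cvg_cst.
exact: cvg_harmonic.
Qed.

Lemma next_node_unif (V : normedModType R[i]) (x : R -> V) :
  {within `[0, t], continuous x} ->
  forall e, 0 < e -> exists N, forall n, (N <= n)%N -> forall s, `[0, t]%classic s ->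
    rnorm (x (next_node n s) - x s) < e.
Proof.
move=> xc e e0; have [d d0 dP] := compact_unif_continuous (@segment_compact _ 0
  t) xc e0.
have /cvgrPdist_lt/(_ _ d0)[N _ NP] := cvg_mesh.
exists N => n Nn s st; have := st; rewrite /= in_itv /= => st'.
have [/andP[s1 s2] s3] := next_nodeP n st'.
apply: dP => //.
  by rewrite /= in_itv /= s2 (le_trans _ s1) //; case/andP: st'.
rewrite ger0_norm ?subr_ge0 //; apply: le_lt_trans s3 _.
have := NP n Nn; rewrite /= sub0r normrN ger0_norm //.
by rewrite mulr_ge0 ?invr_ge0.
Qed.

End UniformGrid.

Section MildEnergy.
Variables (R : realType) (X : hilbertType R) (T : R -> X -> X).
Hypotheses (hT : C0_semigroup T) (cT : contractive T).
Local Notation mu := (@lebesgue_measure R).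
Variables (f x : R -> X) (x0 : X).
Hypothesis mild : forall t, 0 <= t -> exists2 I,
  bochner_integral `[0, t] (fun s => T (t - s) (f s)) I & x t = T t x0 + I.

(** By contractivity [g] also bounds the norm of T(b-s) f(s), so [M * g], with [M] a bound of the
    path, dominates the integrands of all grids. *)
Lemma mild_energy (t : R) (g : R -> R) H : 0 <= t ->
  {within `[0, t], continuous x} ->
  ae_integral mu `[0, t] g H -> (forall s, `[0, t]%classic s -> rnorm (f s) <= g s) ->
  exists2 J, ae_integral mu `[0, t] (fun s => rinner (f s) (x s)) J &
    rnorm (x t) ^+ 2 - rnorm x0 ^+ 2 <= 2 * J.
Proof.
move=> t0 xc gH fg.
have mt : @measurable _ (measurableTypeR R) `[0, t]%classic by exact: measurable_itv.
have [M [M0 xM]] := compact_rnorm_bounded (@segment_compact _ 0 t) xc.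
have grid n : exists J, ae_integral mu `[0, t]
      (fun s => rinner (T (next_node t n s - s) (f s)) (x (next_node t n s))) J /\
    rnorm (x t) ^+ 2 - rnorm x0 ^+ 2 <= 2 * J.
  have [J] := mild_grid hT cT mild n.+1 (uniform_grid_mono t0 n) (uniform_grid0 t n).
  by rewrite uniform_grid_end => h1 h2; exists J.
have [J_ J_P] := choice grid.
have [|n||J hJ J_J] := @ae_integral_dominated _ _ _ mu `[0, t]
  (fun n s => rinner (T (next_node t n s - s) (f s)) (x (next_node t n s)))
  (fun s => rinner (f s) (x s)) (fun s => M * g s) J_ (M * H) mt (fun n => (J_P n).1).
- exact: (ae_integralZ M mt gH).
- apply: aeW => r rt; have := rt; rewrite /= in_itv /= => rt'.
  have [/andP[r1 r2] _] := next_nodeP t0 n rt'.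
  apply: le_trans (cauchy_schwarz _ _) _; rewrite mulrC ler_pM ?rnorm_ge0 //.
    by apply: xM; rewrite /= in_itv /= r2 (le_trans _ r1) //; case/andP: rt'.
  by apply: le_trans (fg _ rt); apply: (semigroup_rnorm cT); rewrite subr_ge0.
- apply: aeW => s st; have := st; rewrite /= in_itv /= => st'.
  apply: cvg_rinner.
    apply: (semigroup_cvg0 hT) => [n|].
      by have [/andP[s1 _] _] := next_nodeP t0 n st'; rewrite subr_ge0.
    apply: (@squeeze_cvgr _ _ _ _ (fun=> 0) (fun n => t * n.+1%:R^-1)).
    - apply: nearW => n; have [/andP[s1 _] s2] := next_nodeP t0 n st'.
      by rewrite subr_ge0 s1 s2.
    - exact: cvg_cst.
    - exact: cvg_mesh.
  apply/cvg_rnormP => e e0; have [N NP] := next_node_unif t0 xc e0.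
  by exists N => // n /= Nn; rewrite rnorm_distC NP.
exists J => //.
have : 2 * J_ n @[n --> \oo] --> 2 * J by apply: cvgM => //; exact: cvg_cst.
by move=> /cvgr_to_ge; apply; apply: nearW => n; exact: (J_P n).2.
Qed.

End MildEnergy.

(** * The integrated dissipation inequality *)

Section MildDissipation.
Variables (R : realType) (X U1 U2 Z : hilbertType R) (T : R -> X -> X).
Variables (B1 : {linear Z -> X}) (B2 : {linear U2 -> X}).
Variable F : {bilinear U1 -> X -> Z}.
Hypotheses (hT : C0_semigroup T) (cT : contractive T).
Hypotheses (hB1 : continuous B1) (hB2 : continuous B2) (hF : bounded_bilinear F).
Local Notation mu := (@lebesgue_measure R).

(** Two integrals of the supply rate arise: the real one from [mild_energy] and the complex Bochner
    integral. Uniqueness of real integrals identifies the former with the real part of the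
    latter. *)
Lemma mild_dissipation (u1 : R -> U1) (u2 : R -> U2) (x0 : X) (x : R -> X) (t : R) :
  L1loc u1 -> L1loc u2 -> mild_solution B1 B2 F T u1 u2 x0 x -> 0 <= t ->
  exists2 I : R[i]^o,
    bochner_integral `[0, t]
      (fun s => inner_pair (u1 s, u2 s) (output B1 B2 F x s) : R[i]^o) I &
    2^-1 * rnorm (x t) ^+ 2 - 2^-1 * rnorm x0 ^+ 2 <= complex.Re I.
Proof.
move=> [_ u1L] [_ u2L] [xc mild] t0.
have mt : @measurable _ (measurableTypeR R) `[0, t]%classic by exact: measurable_itv.
have sub : (`[0, t]%classic : set R) `<=` `[0, +oo[%classic.
  by move=> s /=; rewrite !in_itv /= andbT => /andP[].
have {}xc : {within `[0, t], continuous x} by exact: continuous_subspaceW xc.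
have [M [M0 xM]] := compact_rnorm_bounded (@segment_compact _ 0 t) xc.
have [s [ss su sC]] := bochner_integrable_pair mt
  (u1L _ (@segment_compact _ 0 t) sub) (u2L _ (@segment_compact _ 0 t) sub).
have [K [K0 KP]] := input_lipschitz hB1 hB2 hF.
have Kb := input_bounded KP.
have [H uH _] : exists2 H, ae_integral mu `[0, t] (fun r => rnorm (u1 r, u2 r))
  H & True.
  have [||H ? _] := @ae_integral_lipschitz _ _ _ s (fun r => (u1 r, u2 r)) mt ss su sC
    (@rnorm _ (U1 * U2)%type) 1; [exact: rnorm0|move=> v w|by exists H].
  by rewrite mul1r; exact: rnorm_dist.
have [||J hJ xJ] := @mild_energy _ _ _ hT cT _ _ _ mild t
    (fun r => K * (1 + M) * rnorm (u1 r, u2 r)) (K * (1 + M) * H) t0 xc.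
- exact: ae_integralZ.
- move=> r rt; apply: le_trans (Kb (u1 r, u2 r) (x r)) _.
  by rewrite ler_wpM2r ?rnorm_ge0 // ler_wpM2l ?(ltW K0) // lerD2l xM.
pose G (v : U1 * U2) (y : X) : R[i]^o := inner (input B1 B2 F v y) y.
have [I GI] : bochner_integrable `[0, t] (fun r => G (u1 r, u2 r) (x r)).
  (* For states bounded by [M], the input bound contributes a factor K (1 + M) and the pairing with
     the state a factor [M]; the constant K (1 + M)^2 covers all terms. *)
  apply: (@bochner_integrable_product _ _ mt _ _ G (K * (1 + M) ^+ 2) M s _
    (fun n r => x (next_node t n r))) => //.
  - by rewrite mulr_ge0 ?sqr_ge0 // ltW.
  - by move=> b; rewrite /G input0 inner0l.
  - move=> v y v' y' yM y'M.
    have -> : G v y - G v' y' =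
        (inner (input B1 B2 F v y - input B1 B2 F v' y') y : R[i]^o) +
        (inner (input B1 B2 F v' y') (y - y') : R[i]^o).
      by rewrite /G innerBl innerBr addrA subrK.
    apply: le_trans (rnormD _ _) _.
    apply: le_trans (lerD (rnorm_inner _ _) (rnorm_inner _ _)) _.
    have h1 := KP v y v' y'; have h2 := Kb v' y'.
    move: (rnorm_ge0 y) (rnorm_ge0 y') (rnorm_ge0 (v - v')) (rnorm_ge0 v')
      (rnorm_ge0 (y - y')).
    move: (rnorm (input _ _ _ _ _ - _)) (rnorm (input _ _ _ _ _)) (rnorm (v -
      v')) (rnorm v') (rnorm (y - y')) (rnorm y) (rnorm y') h1 h2 yM y'M.
    move=> p q d a e r r' h1 h2 yM y'M r0 r'0 d0 a0 e0.
    have h1' : p <= K * (1 + M) * d + K * a * e.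
      apply: le_trans h1 _; rewrite lerD2r ler_wpM2r //.
      by rewrite ler_wpM2l ?(ltW K0) // lerD2l.
    have h2' : q <= K * (1 + M) * a.
      by apply: le_trans h2 _; rewrite ler_wpM2r // ler_wpM2l ?(ltW K0) // lerD2l.
    have A0 : 0 <= K * (1 + M) * d + K * a * e.
      by rewrite addr_ge0 ?mulr_ge0 ?addr_ge0 ?(ltW K0).
    apply: (@le_trans _ _ ((K * (1 + M) * d + K * a * e) * M + K * (1 + M) * a * e)).
      rewrite lerD // ?ler_wpM2r //.
      by apply: le_trans (ler_wpM2r r0 h1') _; rewrite ler_wpM2l.
    rewrite -subr_ge0.
    have -> : K * (1 + M) ^+ 2 * (d + a * e) -
      ((K * (1 + M) * d + K * a * e) * M + K * (1 + M) * a * e) =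
      K * d * (1 + M) + K * (a * e) * M ^+ 2 by ring.
    by rewrite addr_ge0 // !mulr_ge0 ?sqr_ge0 ?addr_ge0 ?(ltW K0).
  - by move=> n; exact: simple_function_cell_end.
  - move=> n r /=; rewrite in_itv /= => rt.
    have [/andP[r1 r2] _] := next_nodeP t0 n rt.
    by apply: xM; rewrite /= in_itv /= r2 (le_trans _ r1) //; case/andP: rt.
  - exact: next_node_unif.
have GE r : G (u1 r, u2 r) (x r) = inner_pair (u1 r, u2 r) (output B1 B2 F x r).
  by rewrite inner_pair_output.
exists I.
  by rewrite (_ : (fun s => _) = (fun r => G (u1 r, u2 r) (x r))) //;
    apply/funext => r; rewrite GE.
have hI : ae_integral mu `[0, t] (fun r => complex.Re (G (u1 r, u2 r) (x r)))
  (complex.Re I).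
  apply: (@bochner_real_linear _ _ _ _ _ (fun z : R[i]^o => complex.Re z) 1 mt GI).
  - exact: ReD.
  - exact: ReZ.
  - by move=> v; rewrite mul1r Re_le_rnorm.
rewrite (ae_integral_unique mt hI hJ).
by rewrite -mulrBr mulrC ler_pdivrMr // mulrC.
Qed.

End MildDissipation.

(** * Generators, resolvents and the extrapolation space *)

Section Generators.
Variables (R : realType) (X : hilbertType R).
Variables (D : set X) (A : X -> X) (T : R -> X -> X).
Hypotheses (hA : generates D A T) (cT : contractive T).

Lemma generator_unique y l : h^-1%:C *: (T h y - y) @[h --> 0^'+] --> l ->
  D y /\ A y = l.
Proof.
have [_ DP AP] := hA => yl.
have Dy : D y by apply/DP; exists l.
split=> //; exact: (cvg_unique (@norm_hausdorff _ _) (AP _ Dy) yl).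
Qed.

(** [T h] is continuous and commutes with [T k], so it maps the difference quotients of [y] to those
    of [T h y]. *)
Lemma generator_semigroup h y : 0 <= h -> D y ->
  D (T h y) /\ A (T h y) = T h (A y).
Proof.
move=> h0 Dy; have [hT _ AP] := hA; have [Tlc _ Tadd _] := hT.
apply: generator_unique.
have [_ Tc] := Tlc h h0.
have yA : T h (k^-1%:C *: (T k y - y)) @[k --> 0^'+] --> T h (A y).
  apply: (@cvg_comp _ _ _ (fun k => k^-1%:C *: (T k y - y)) (T h)); first exact: AP.
  exact: Tc.
apply: cvg_trans yA; apply: near_eq_cvg.
have : \forall k \near (0 : R)^'+, 0 < k by exact: nbhs_right_gt.
apply: filterS => k k0; rewrite (semigroupZ hT) //; congr (_ *: _).
rewrite (semigroupD hT) // -(scaleN1r y) (semigroupZ hT) // scaleN1r; congr (_ - _).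
by rewrite -!Tadd ?(ltW k0) // addrC.
Qed.

Lemma resolvent_semigroup lambda Rl h y : is_resolvent D A lambda Rl -> 0 <= h ->
  Rl (T h y) = T h (Rl y).
Proof.
move=> [_ RlD RlK] h0; have [Dz zy] := RlD y; have [hT _ _] := hA.
have [DTz ATz] := generator_semigroup h0 Dz.
rewrite -[in LHS]zy (semigroupD hT) // -scaleN1r !(semigroupZ hT) // scaleN1r.
by rewrite -ATz RlK.
Qed.

(** The easy half of the Lumer-Phillips theorem: contractivity gives Re <T(h) y, y> <= |y|^2, so the
    difference quotients paired with [y] are nonpositive. *)
Lemma generator_dissipative y : D y -> rinner (A y) y <= 0.
Proof.
have [_ _ AP] := hA => /AP Ay.
have : rinner (h^-1%:C *: (T h y - y)) y @[h --> 0^'+] --> rinner (A y) y.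
  by apply: cvg_rinner => //; exact: cvg_cst.
move=> /cvgr_to_le; apply.
have : \forall k \near (0 : R)^'+, 0 < k by exact: nbhs_right_gt.
apply: filterS => k k0;
  rewrite rinnerZl pmulr_rle0 ?invr_gt0 // rinnerBl rinnerxx subr_le0.
apply: le_trans (rinner_le _ _) _; rewrite expr2 ler_wpM2r ?rnorm_ge0 //.
by apply: (semigroup_rnorm cT); exact: ltW.
Qed.

(** The norm of [j z] is |Rl z| and [Rl] commutes with the semigroup, so the difference quotients of
    [j y] converge in [Xm1] exactly as those of [Rl y] do in [X]. Thus A (Rl y) = Rl v, whence y =
    lambda Rl y - A (Rl y) = Rl (lambda y - v) lies in the range of [Rl], that is, in [D]. *)
Lemma extrapolation_domain (Xm1 : completeNormedModType R[i]) (j : X -> Xm1)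
    (Tm1 : R -> Xm1 -> Xm1) (Am1 : Xm1 -> Xm1) (y v : X) :
  is_extrapolation D A T j Tm1 Am1 -> Am1 (j y) = j v -> D y /\ A y = v.
Proof.
move=> [[lj _] [lambda [Rl [res jR]]] jT _ [_ _ Am1P]] jv.
have [hT _ AP] := hA; have [[lRl _] RlD RlK] := res.
have jB a b : j (a - b) = j a - j b.
  by have := lj (-1) b a; rewrite !scaleN1r => e; rewrite [a - b]addrC e addrC.
have RlB a b : Rl (a - b) = Rl a - Rl b.
  by have := lRl (-1) b a; rewrite !scaleN1r => e; rewrite [a - b]addrC e addrC.
have jZ c a : j (c *: a) = c *: j a.
  by have := lj c a 0; rewrite -[in j 0](subrr a) jB subrr !addr0.
have RlZ c a : Rl (c *: a) = c *: Rl a.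
  by have := lRl c a 0; rewrite -[in Rl 0](subrr a) RlB subrr !addr0.
have jcvg := Am1P (j y) (imageP j I); rewrite jv in jcvg.
have Rlcvg : h^-1%:C *: (T h (Rl y) - Rl y) @[h --> 0^'+] --> Rl v.
  apply/cvg_rnormP => e e0; have /cvg_rnormP/(_ _ e0) := jcvg.
  have : \forall k \near (0 : R)^'+, 0 < k by exact: nbhs_right_gt.
  apply: filterS2 => h h0; rewrite jT ?(ltW h0) // -jB -jZ -jB /rnorm jR.
  by rewrite RlB RlZ RlB (resolvent_semigroup _ res) ?(ltW h0).
have [_ ARl] := generator_unique Rlcvg.
have yE : Rl (lambda *: y - v) = y.
  by rewrite RlB RlZ -ARl (RlD y).2.
have [Dy] := RlD (lambda *: y - v); rewrite yE in Dy * => /addrI/oppr_inj.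
by [].
Qed.

End Generators.

(** * Continuity and derivatives on the half-line *)

Section HalfLine.
Variable R : realType.
Local Notation mu := (@lebesgue_measure R).

(** A negative value at [t] persists on some []t, t + d[], a set of positive measure. An interval to
    the right stays in the half-line even when [t = 0]. *)
Lemma ae_ge0_continuous (phi : R -> R) :
  {within `[0, +oo[, continuous phi} -> {ae mu, forall t, 0 <= t -> 0 <= phi t} ->
  forall t, 0 <= t -> 0 <= phi t.
Proof.
move=> /subspace_continuousP cphi [N [mN N0 phiN]] t t0.
rewrite leNgt; apply/negP => phit.
have tI : `[0, +oo[%classic t by rewrite /= in_itv /= t0.
have := cphi _ tI; move=> /cvgrPdist_lt/(_ (- phi t)); rewrite oppr_gt0 => /(_ phit).
move=> /nbhs_normP[d /= d0 dP].
have sub : `]t, (t + d)[%classic `<=` N.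
  move=> s /=; rewrite in_itv /= => /andP[ts std]; apply: phiN => /= h.
  have s0 : 0 <= s by rewrite (le_trans t0) ?ltW.
  have := dP s; rewrite /= distrC gtr0_norm ?subr_gt0 // ltrBlDl => /(_ std).
  rewrite in_itv /= andbT s0 => /(_ isT); rewrite ltr_norml => /andP[+ _].
  by rewrite opprK ltrBrDl gtrDr ltNge; move: (h s0) => ->.
have : (mu `]t, (t + d)%R[%classic <= 0)%E.
  by rewrite -N0; apply: le_measure; rewrite ?inE //; exact: measurable_itv.
rewrite lebesgue_measure_itv /= lte_fin ltrDl d0 -EFinD lee_fin.
by rewrite addrAC subrr add0r leNgt d0.
Qed.

Lemma is_deriv_ge0_cvg (V : normedModType R[i]) (x : R -> V) t l :
  is_deriv_ge0 x t l -> x @ within `[0, +oo[ (nbhs t) --> x t.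
Proof.
move=> /cvg_rnormP/(_ _ ltr01)/nbhs_normP[d /= d0 dP].
apply/cvg_rnormP => e e0.
pose c := rnorm l + 1; have c0 : 0 < c by rewrite ltr_wpDl ?rnorm_ge0.
(* Within [d] the difference quotient has norm below [c], so |x s - x t| <= c |s - t|. *)
apply/nbhs_normP; exists (Num.min d (e / c)) => /=.
  by rewrite lt_min d0 divr_gt0.
move=> s /=; rewrite lt_min => /andP[sd sec] s0.
have [->|st] := eqVneq s t; first by rewrite subrr rnorm0.
have := dP s sd st s0.
set q := _ *: _ => ql.
have st0 : s - t != 0 by rewrite subr_eq0.
have -> : x t - x s = - ((s - t)%:C *: q).
  by rewrite scalerA -real_complexM divff // scale1r opprB.
rewrite rnormN rnormZr.
have qc : rnorm q < c.
  by rewrite -(subKr l q); apply: le_lt_trans (rnormB _ _) _; rewrite /c ltrD2l.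
apply: le_lt_trans (ler_wpM2l _ (ltW qc)) _ => //.
by rewrite -ltr_pdivlMr // distrC.
Qed.

(** |x s|^2 - |x t|^2 = Re <x s - x t, x s + x t>, and the second argument tends to [x t + x t]. *)
Lemma is_rderiv_rnorm2 (H : hilbertType R) (x : R -> H) t l :
  is_deriv_ge0 x t l ->
  is_rderiv_ge0 (fun s => rnorm (x s) ^+ 2) t (2 * rinner l (x t)).
Proof.
move=> xl; have xt := is_deriv_ge0_cvg xl; rewrite /is_rderiv_ge0.
have -> : 2 * rinner l (x t) = rinner l (x t + x t).
  by rewrite rinnerDr mulr2n mulrDl mul1r.
rewrite (_ : (fun s => _) =
  fun s => rinner ((s - t)^-1%:C *: (x s - x t)) (x s + x t)); last first.
  apply/funext => s; rewrite rinnerZl; congr (_ * _).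
  by rewrite rinnerBl !rinnerDr !rinnerxx (rinnerC (x t) (x s)); ring.
apply: cvg_rinner => //; apply: cvgD; last exact: cvg_cst.
apply: cvg_trans xt => P; exact: nbhs_dnbhs.
Qed.

End HalfLine.

(** * The pointwise dissipation inequality *)

Section ClassicalDissipation.
Variables (R : realType) (X U1 U2 Z : hilbertType R).
Variables (D : set X) (A : X -> X) (T : R -> X -> X).
Variables (B1 : {linear Z -> X}) (B2 : {linear U2 -> X}).
Variable F : {bilinear U1 -> X -> Z}.
Hypotheses (hA : generates D A T) (cT : contractive T).
Hypotheses (hB1 : continuous B1) (hB2 : continuous B2) (hF : bounded_bilinear F).

Lemma input_cvg (S : Type) (G : set_system S) {FG : Filter G}
    (w : S -> U1 * U2) (y : S -> X) w0 y0 :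
  w @ G --> w0 -> y @ G --> y0 ->
  input B1 B2 F (w s) (y s) @[s --> G] --> input B1 B2 F w0 y0.
Proof.
move=> wG yG; have [K [K0 KP]] := input_lipschitz hB1 hB2 hF.
have w0G : rnorm (w s - w0) @[s --> G] --> 0 by apply/cvg_rnorm0P.
have y0G : rnorm (y s - y0) @[s --> G] --> 0 by apply/cvg_rnorm0P.
apply: (@cvg_rnorm_squeeze _ _ _ _ _ _ _ (fun s =>
  K * (1 + rnorm (y s)) * rnorm (w s - w0) + K * rnorm w0 * rnorm (y s - y0))).
  by apply: filterE => s; exact: KP.
rewrite [X in _ --> X](_ : 0 =
  K * (1 + rnorm y0) * 0 + K * rnorm w0 * 0); last by rewrite !mulr0 addr0.
apply: cvgD; last by apply: cvgM y0G; exact: cvg_cst.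
apply: cvgM w0G; apply: cvgM; first exact: cvg_cst.
by apply: cvgD; [exact: cvg_cst | exact: (cvg_rnorm yG)].
Qed.

Lemma classical_dissipation (Xm1 : completeNormedModType R[i]) (j : X -> Xm1)
    (Tm1 : R -> Xm1 -> Xm1) (Am1 : Xm1 -> Xm1)
    (u1 : R -> U1) (u2 : R -> U2) (x0 : X) (x : R -> X) (t : R) :
  is_extrapolation D A T j Tm1 Am1 ->
  {within `[0, +oo[, continuous u1} -> {within `[0, +oo[, continuous u2} ->
  classical_solution B1 B2 F j Am1 u1 u2 x0 x -> 0 <= t ->
  exists d : R, is_rderiv_ge0 (fun s => rnorm (x s) ^+ 2) t d /\
    2^-1 * d <= complex.Re (inner_pair (u1 t, u2 t) (output B1 B2 F x t)).
Proof.
move=> ext /subspace_continuousP u1c /subspace_continuousP u2c [x' [xx' x'c _ ode]] t0.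
exists (2 * rinner (x' t) (x t)); split; first exact/is_rderiv_rnorm2/xx'.
rewrite mulKf ?pnatr_eq0 // inner_pair_output // -subr_ge0.
pose f s := input B1 B2 F (u1 s, u2 s) (x s).
have jB a b : j (a - b) = j a - j b.
  have [[lj _] _ _ _ _] := ext.
  by have := lj (-1) b a; rewrite !scaleN1r => e; rewrite [a - b]addrC e addrC.
apply: (@ae_ge0_continuous R (fun s => rinner (f s) (x s) - rinner (x' s) (x s))) => //.
  move/subspace_continuousP in x'c.
  apply/subspace_continuousP => s s0.
  have sge0 : 0 <= s by move: s0; rewrite /= in_itv /= andbT.
  have xc := is_deriv_ge0_cvg (xx' s sge0).
  apply: cvgB; apply: cvg_rinner => //; last exact: x'c.
  apply: input_cvg => //; apply: cvg_pair; [exact: u1c | exact: u2c].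
apply: filterS ode => s ode s0; have := ode s0 => {}ode.
(* The equation reads [Am1 (j (x s)) = j (x' s - f s)], with right-hand side in the copy of [X]. *)
have [Dx Ax] : D (x s) /\ A (x s) = x' s - f s.
  apply: (extrapolation_domain hA ext).
  have jf : j (f s) = j (B1 (F (u1 s) (x s))) + j (B2 (u2 s)).
    have jN b : j (- b) = - j b by rewrite -sub0r jB -[in j 0](subrr b) jB subrr sub0r.
    by rewrite /f /input -[in LHS](opprK (B2 _)) jB jN opprK.
  by rewrite jB ode jf -(addrA (Am1 _)) addrK.
have := generator_dissipative hA cT Dx; rewrite Ax rinnerBl.
by rewrite subr_le0 subr_ge0.
Qed.

End ClassicalDissipation.

Theorem theorem2 (R : realType) (X U1 U2 Z : hilbertType R)
    (D : set X) (A : X -> X) (T : R -> X -> X)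
    (B1 : {linear Z -> X}) (B2 : {linear U2 -> X})
    (F : {bilinear U1 -> X -> Z})
    (hA : generates D A T) (hT : contractive T)
    (hB1 : continuous B1) (hB2 : continuous B2) (hF : bounded_bilinear F) :
  (forall (Xm1 : completeNormedModType R[i]) (j : X -> Xm1)
      (Tm1 : R -> Xm1 -> Xm1) (Am1 : Xm1 -> Xm1)
      (u1 : R -> U1) (u2 : R -> U2) (x0 : X) (x : R -> X),
    is_extrapolation D A T j Tm1 Am1 ->
    W11loc u1 -> W11loc u2 -> D x0 ->
    classical_solution B1 B2 F j Am1 u1 u2 x0 x ->
    forall t : R, 0 <= t ->
    exists d : R, is_rderiv_ge0 (fun s => rnorm (x s) ^+ 2) t d /\
      2^-1 * d <=
        complex.Re (inner_pair (u1 t, u2 t) (output B1 B2 F x t)))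
  /\
  (forall (u1 : R -> U1) (u2 : R -> U2) (x0 : X) (x : R -> X),
    L1loc u1 -> L1loc u2 ->
    mild_solution B1 B2 F T u1 u2 x0 x ->
    forall t : R, 0 <= t ->
    exists2 I : R[i]^o,
      bochner_integral `[0, t]
        (fun s => inner_pair (u1 s, u2 s) (output B1 B2 F x s) : R[i]^o) I &
      2^-1 * rnorm (x t) ^+ 2 - 2^-1 * rnorm x0 ^+ 2 <= complex.Re I).
Proof.
have [hT0 _ _] := hA; split.
  move=> Xm1 j Tm1 Am1 u1 u2 x0 x ext [u1c _ _] [u2c _ _] _ sol t.
  exact: (classical_dissipation hA hT hB1 hB2 hF ext u1c u2c sol).
by move=> u1 u2 x0 x u1L u2L sol t;
  exact: (mild_dissipation hT0 hT hB1 hB2 hF u1L u2L sol).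
Qed.
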